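(* Let $J=2$. For all $\theta\in\Theta^{\mathrm{ind}}$ and all $n\ge2$, $$(1-\alpha_n)\inf_{h\in\mathcal{H}_n}\mathcal{R}_n^{\mathrm{class}}(\theta,h)\le\inf_{g\in\mathcal{G}_n}\mathcal{R}_n^{\mathrm{clust}}(\theta,g)\le\inf_{h\in\mathcal{H}_n}\mathcal{R}_n^{\mathrm{class}}(\theta,h),$$ where, with $\varepsilon_{n,\theta}=\frac12-\inf_{h\in\mathcal{H}_n}\mathcal{R}_n^{\mathrm{class}}(\theta,h)$, $$\alpha_n=2\min\left(2(1+2\varepsilon_{n,\theta})\frac{(1-4\varepsilon_{n,\theta}^2)^{\frac{n-2}2}}{n\log\left(\frac{1+2\varepsilon_{n,\theta}}{1-2\varepsilon_{n,\theta}}\right)},\ \frac1{1-2\varepsilon_{n,\theta}}\sqrt{\frac{\pi}{2n}}\right)$$ (with the conventions that the first term in the minimum is $+\infty$ if $\varepsilon_{n,\theta}=0$ and that $\alpha_n=0$ if $\varepsilon_{n,\theta}=\frac12$).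
   Context: Model. $J\ge2$ is an integer, $\mathbb{X}=\{1,\dots,J\}$, $(\mathbb{Y},\mathcal{Y})$ is a Polish space with its Borel $\sigma$-field and $\mathcal{L}$ is a dominating ($\sigma$-finite) measure on it. A parameter is $\theta=(\nu,Q,(f_x)_{x\in\mathbb{X}})$ with $\nu$ a probability vector on $\mathbb{X}$, $Q$ a $J\times J$ transition matrix and $f_x$ probability densities with respect to $\mathcal{L}$. Under $\mathbb{P}_\theta$ (expectation $\mathbb{E}_\theta$), $(X_i)_{i\ge1}$ is a Markov chain on $\mathbb{X}$ with initial law $\nu$ and transition matrix $Q$ and, conditionally on $(X_i)_{i\ge 1}$, the $Y_i$ are independent, $Y_i$ having density $f_{X_i}$. $Y_{1:n}=(Y_1,\dots,Y_n)$. $\Theta^{\mathrm{ind}}$ is the set of parameters for which all rows of $Q$ equal $\nu$ (so the $X_i$ are i.i.d. with law $\nu$). Risks. $\mathcal{P}[n]$ is the set of partitions of $[n]=\{1,\dots,n\}$. $\mathcal{G}_n$ is the set of measurable maps $g:\mathbb{Y}^n\to\mathcal{P}[n]$ (clusterers) and $\mathcal{H}_n$ the set of measurable maps $h=(h_1,\dots,h_n):\mathbb{Y}^n\to\mathbb{X}^n$ (classifiers). $\Pi_n$ is the partition of $[n]$ into the nonempty sets among $\{i:X_i=x\}$, $x\in\mathbb{X}$. For partitions $A,B$ of $[n]$, $\ell(A,B)=1-\frac1n\sup_M\sum_{\{C,C'\}\in M}\mathrm{Card}(C\cap C')$, the supremum being over matchings $M$ between the blocks of $A$ and the blocks of $B$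 in the complete bipartite graph (each block is in at most one edge). $\mathcal{R}_n^{\mathrm{clust}}(\theta,g)=\mathbb{E}_\theta[\ell(g(Y_{1:n}),\Pi_n)]$ and $\mathcal{R}_n^{\mathrm{class}}(\theta,h)=\mathbb{E}_\theta[\frac1n\sum_{i=1}^n\mathbf{1}_{h_i(Y_{1:n})\ne X_i}]$. *)

(* Defs.v *)
From HB Require Import structures.
From mathcomp Require Import all_boot all_order all_algebra.
Set Implicit Arguments.
Unset Strict Implicit.
Unset Printing Implicit Defensive.
Import Order.TTheory GRing.Theory Num.Theory.

(* Indices are shifted by one throughout: [n] is 'I_n = {0, ..., n-1} and     *)
(* the label set {1, ..., J} is 'I_J. Partitions of [n] are the               *)
(* A : {set {set 'I_n}} such that finset.partition A [set: 'I_n].             *)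

Definition label_partition (n J : nat) (x : n.-tuple 'I_J) : {set {set 'I_n}} :=
  [set [set i | tnth x i == c] | c : 'I_J] :\ set0.

(* The edge {C, C'} between a block C of A and a block C' of B is the pair    *)
(* (C, C'), which keeps the two sides apart even when A and B share blocks.   *)
Definition matching (n : nat) (A B : {set {set 'I_n}})
    (M : {set {set 'I_n} * {set 'I_n}}) : bool :=
  (M \subset setX A B) &&
  [forall e in M, forall e' in M,
     ((e.1 == e'.1) || (e.2 == e'.2)) ==> (e == e')].

Definition matching_weight (n : nat) (A B : {set {set 'I_n}}) : nat :=
  \max_(M : {set {set 'I_n} * {set 'I_n}} | matching A B M)
    \sum_(e in M) #|e.1 :&: e.2|.

From mathcomp Require Import all_classical all_reals all_analysis.
Local Open Scope classical_set_scope.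
Local Open Scope ring_scope.

Definition loss (R : realType) (n : nat) (A B : {set {set 'I_n}}) : R :=
  1 - (n%:R)^-1 * (matching_weight A B)%:R.
Arguments loss R {n} A B.

Definition completely_metrizable (R : realType) (T : topologicalType) : Prop :=
  exists (M : metricType R) (phi : T -> M) (psi : M -> T),
    [/\ cancel phi psi, cancel psi phi, continuous phi, continuous psi
      & forall F : set_system M, ProperFilter F -> cauchy F ->
          exists l : M, F --> l].

Definition polish (R : realType) (T : topologicalType) : Prop :=
  (exists2 D : set T, countable D & dense D) /\ completely_metrizable R T.

Notation borel T := (g_sigma_algebraType (@open T)).

Section Model.
Context {R : realType} {T : ptopologicalType}.
Variable L : {sigma_finite_measure set (borel T) -> \bar R}.

Record density (f : borel T -> R) : Prop := {
  density_measurable : measurable_fun setT f ;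
  density_ge0 : forall y, 0 <= f y ;
  density_int : (\int[L]_y (f y)%:E = 1)%E
}.

Record param (J : nat) := Param {
  nu : 'rV[R]_J ;
  Q : 'M[R]_J ;
  f : 'I_J -> borel T -> R ;
  nu_ge0 : forall x, 0 <= nu 0 x ;
  nu_sum : \sum_x nu 0 x = 1 ;
  Q_ge0 : forall x x', 0 <= Q x x' ;
  Q_sum : forall x, \sum_x' Q x x' = 1 ;
  f_density : forall x, density (f x)
}.

Definition Theta_ind (J : nat) : set (param J) :=
  [set theta | forall x, row x (Q theta) = nu theta].

Section Realization.
Context {d : measure_display} {Omega : measurableType d}.
Variable P : probability Omega R.
Context {J : nat}.
Variables (X : nat -> Omega -> 'I_J) (Y : nat -> Omega -> borel T).

(* The sigma-field generated by the whole chain (X i)_i. *)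
Definition sigma_chain : set (set Omega) :=
  <<s [set B | exists i x, B = X i @^-1` [set x]] >>.

(* (X, Y) has the law P_theta. The last field says that, conditionally on     *)
(* sigma_chain, the Y i are independent, Y i having density f (X i):          *)
(* P(Y_i \in A_i for i < n | X) = \prod_(i < n) \int_(A_i) f_(X_i) dL.        *)
Record hmm (theta : param J) : Prop := {
  hmm_X_measurable : forall i x, measurable (X i @^-1` [set x]) ;
  hmm_Y_measurable : forall i, measurable_fun setT (Y i) ;
  hmm_init : forall x, P (X 0%N @^-1` [set x]) = (nu theta 0 x)%:E ;
  hmm_markov : forall (n : nat) (x : nat -> 'I_J),
    P [set w | forall i, (i <= n.+1)%N -> X i w = x i] =
    (P [set w | forall i, (i <= n)%N -> X i w = x i] *
     (Q theta (x n) (x n.+1))%:E)%E ;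
  hmm_emission : forall (n : nat) (A : nat -> set (borel T)) (B : set Omega),
    (forall i, measurable (A i)) -> sigma_chain B ->
    P (B `&` [set w | forall i, (i < n)%N -> A i (Y i w)]) =
    (\int[P]_(w in B)
       (\prod_(i < n) \int[L]_(y in A i) f theta (X i w) y)%R%:E)%E
}.

Variable n : nat.

Definition X1n (w : Omega) : n.-tuple 'I_J := [tuple X i w | i < n].
Definition Y1n (w : Omega) : n.-tuple (borel T) := [tuple Y i w | i < n].

Definition clusterers : set (n.-tuple (borel T) -> {set {set 'I_n}}) :=
  [set g | (forall y, finset.partition (g y) [set: 'I_n]%SET) /\
           (forall A, measurable (g @^-1` [set A]))].

Definition classifiers : set (n.-tuple (borel T) -> n.-tuple 'I_J) :=
  [set h | forall x, measurable (h @^-1` [set x])].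

Definition clust_risk (g : n.-tuple (borel T) -> {set {set 'I_n}}) : R :=
  fine 'E_P[fun w => loss R (g (Y1n w)) (label_partition (X1n w))].

Definition class_risk (h : n.-tuple (borel T) -> n.-tuple 'I_J) : R :=
  fine 'E_P[fun w => (n%:R)^-1 *
    \sum_(i < n) (tnth (h (Y1n w)) i != X i w)%:R].

(* Both risks lie in [0, 1], and constant maps are admissible when 0 < J:     *)
(* these are infima of nonempty bounded sets of reals.                        *)
Definition clust_risk_inf : R := inf [set clust_risk g | g in clusterers].
Definition class_risk_inf : R := inf [set class_risk h | h in classifiers].

End Realization.
End Model.

Section Alpha.
Context {R : realType}.

Definition alpha_fst (n : nat) (e : R) : \bar R :=
  if e == 0 then +oo%E
  else (2 * (1 + 2 * e) *
        ((1 - 4 * e ^+ 2) `^ ((n%:R - 2) / 2) /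
         (n%:R * ln ((1 + 2 * e) / (1 - 2 * e)))))%:E.

Definition alpha_snd (n : nat) (e : R) : R :=
  (1 - 2 * e)^-1 * Num.sqrt (pi / (2 * n%:R)).

Definition alpha (n : nat) (e : R) : R :=
  if e == 1 / 2 then 0
  else 2 * fine (Order.min (alpha_fst n e) (alpha_snd n e)%:E).

End Alpha.

(* Main.v *)
(** With labels in {0, 1} and i.i.d. pairs (X_i, Y_i), the labels are, given the
    observations, independent with P(X_i = c | Y) = post c Y_i.

    Classification: the Bayes rule b is optimal and its errors are i.i.d., so
    the number D of errors is Bin(n, r) with r the optimal risk.

    Clustering: matching a two-block partition with the true one costs
    min(D', n - D') / n = 1/2 - |S| / 2n, where S is a signed sum of the labels
    (as +1/-1).  An arbitrary partition is no better, label by label, than the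
    average over k uniform in [n] of the two-block partition {block of k, rest}.
    Among all choices of signs, E|S| is largest for the Bayes signs, because
    (s, t) |-> |s + t| - |s - t| is odd in each variable and supermodular.
    Hence the optimal clustering risk is at least E min(D, n - D) / n
    = r - E(2D - n)^+ / n, and E(2D - n)^+ is bounded by sqrt n (variance) and,
    from v^+ <= exp(s v) / s with exp(2 s) = (1 - r) / r, by the exponential
    term. *)
From HB Require Import structures.
Require Import Defs.
From mathcomp Require Import all_boot all_order all_algebra.
From mathcomp Require Import ring lra.
Set Implicit Arguments.
Unset Strict Implicit.
Unset Printing Implicit Defensive.
Import Order.TTheory GRing.Theory Num.Theory.
Local Open Scope ring_scope.

(** * Signed sums of independent labels *)

(** A clusterer is compared with Bayes conditionally on the observations: there its partition is
    fixed, the labels are independent, and every quantity is a finite sum ([prodE]). Given the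
    observations, however, the Bayes errors are not identically distributed. The lower bound is
    therefore a function of the error pattern alone, and it is evaluated a second time without
    conditioning, where this pattern has i.i.d. entries.

    Supermodularity enters as follows. Given competing signs, let s be the part of the Bayes sum
    over the indices where they agree with the Bayes signs and t the rest. The Bayes sum is s + t,
    the competitor s - t, and s and t have independent steps biased upwards.

    The exponent with exp(2 s) = (1 - r) / r minimises (1 - r) exp(-s) + r exp(s), with minimum 2
    sqrt(r (1 - r)). As 1 - 4 eps^2 = 4 r (1 - r), this gives exactly the first term of alpha; the
    variance bound beats the second by a factor sqrt(pi / 2). *)

Lemma big_tuple_recl (V : nmodType) (T : finType) n (F : n.+1.-tuple T -> V) :
  \sum_x F x = \sum_c \sum_(x : n.-tuple T) F [tuple of c :: x].
Proof.
rewrite pair_big /=.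
rewrite (reindex (fun cx : T * n.-tuple T => [tuple of cx.1 :: cx.2])) //=.
exists (fun x => (thead x, [tuple of behead x])) => [[c x] _|x _] /=.
  by congr (_, _); apply: val_inj.
by rewrite -tuple_eta.
Qed.

Lemma sum_tuple_prod (V : comNzRingType) (T : finType) n (F : 'I_n -> T -> V) :
  \sum_(x : n.-tuple T) \prod_i F i (tnth x i) = \prod_i \sum_c F i c.
Proof.
elim: n F => [|n IHn] F.
  rewrite big_ord0 (big_pred1 ([tuple] : 0.-tuple T)) ?big_ord0 //.
  by move=> x; rewrite [x]tuple0 /= eqxx.
rewrite big_tuple_recl big_ord_recl mulr_suml; apply: eq_bigr => c _.
rewrite -IHn mulr_sumr; apply: eq_bigr => x _.
by rewrite big_ord_recl tnth0; congr (_ * _); apply: eq_bigr => i _; rewrite tnthS.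
Qed.

Section SignWalk.
Context {R : realFieldType}.
Implicit Types (s : seq (R * bool)) (u v : R -> R -> R).

Definition sg (e : bool) : R := if e then 1 else -1.

Definition step (pt : R * bool) u : R -> R -> R := fun a c =>
  if pt.2 then pt.1 * u (a + 1) c + (1 - pt.1) * u (a - 1) c
  else pt.1 * u a (c + 1) + (1 - pt.1) * u a (c - 1).

(** [walk s u] is E[u S_true S_false] for independent +1/-1 steps: an entry
    (p, t) of [s] is a step of S_t that equals +1 with probability p. *)
Fixpoint walk s u : R := if s is pt :: s' then walk s' (step pt u) else u 0 0.

Definition biased s := all (fun pt => 1 / 2 <= pt.1 <= 1) s.

Lemma eq_walk s u v : (forall a c, u a c = v a c) -> walk s u = walk s v.
Proof.
elim: s u v => [|[p t] s IHs] u v uv /=; first exact: uv.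
by apply: IHs => a c; rewrite /step /= !uv.
Qed.

Lemma walkD s u v k :
  walk s (fun a c => u a c + k * v a c) = walk s u + k * walk s v.
Proof.
elim: s u v => [|[p t] s IHs] u v //=.
rewrite -IHs; apply: eq_walk => a c; rewrite /step /=.
by case: t; ring.
Qed.

Lemma le_walk s u v : biased s -> (forall a c, u a c <= v a c) ->
  walk s u <= walk s v.
Proof.
elim: s u v => [|[p t] s IHs] u v /=; first by move=> _; exact.
move=> /andP[/andP[p2 p1] bs] uv; apply: IHs => // a c; rewrite /step /=.
by case: t; apply: lerD; apply: ler_wpM2l => //; lra.
Qed.

Lemma walk_swap s u : walk s u =
  walk [seq (pt.1, ~~ pt.2) | pt <- s] (fun a c => u c a).
Proof.
elim: s u => [|[p t] s IHs] u //=; rewrite IHs.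
by apply: eq_walk => a c; rewrite /step /=; case: t.
Qed.

(** Since p >= 1/2, making the steps in c symmetric can only decrease the
    expectation of a function nondecreasing in c; it then vanishes by oddness. *)
Lemma walk_odd_ge0 s v : biased s ->
  (forall a c, v a (- c) = - v a c) -> (forall a c, v a (c - 1) <= v a (c + 1)) ->
  0 <= walk s v.
Proof.
elim: s v => [|[p t] s IHs] v /=.
  by move=> _ /(_ 0 0); rewrite oppr0 => v0 _; rewrite (_ : v 0 0 = 0) //; lra.
move=> /andP[/andP[p2 p1] bs] vodd vmono; case: t; rewrite /step /=.
  apply: IHs => // a c; first by rewrite !vodd; ring.
  by apply: lerD; apply: ler_wpM2l => //; lra.
pose avg a c := (v a (c + 1) + v a (c - 1)) / 2.
apply: (@le_trans _ _ (walk s avg)); last first.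
  apply: le_walk => // a c; rewrite /avg.
  have : 0 <= (p - 1 / 2) * (v a (c + 1) - v a (c - 1)).
    by apply: mulr_ge0; rewrite subr_ge0.
  by rewrite mulrBr; lra.
apply: IHs => // a c; rewrite /avg.
  have -> : - c + 1 = - (c - 1) by ring.
  have -> : - c - 1 = - (c + 1) by ring.
  by rewrite !vodd; field.
by have := vmono a (c + 1); have := vmono a (c - 1); rewrite addrK subrK; lra.
Qed.

(** Making a step symmetric now changes the function by (p - 1/2) times a finite
    difference of [u], which is odd and, by supermodularity, nondecreasing in the
    other variable. *)
Lemma walk_supermodular_ge0 s u : biased s ->
  (forall a c, u (- a) c = - u a c) -> (forall a c, u a (- c) = - u a c) ->
  (forall a c, u (a + 1) (c - 1) + u (a - 1) (c + 1) <=
               u (a + 1) (c + 1) + u (a - 1) (c - 1)) ->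
  0 <= walk s u.
Proof.
elim: s u => [|[p t] s IHs] u.
  by move=> _ /(_ 0 0); rewrite oppr0 => u0 _ _ /=; rewrite (_ : u 0 0 = 0) //; lra.
rewrite [biased _]/= => /andP[/andP[/= p2 p1] bs] uodd1 uodd2 usm /=; case: t.
  pose avg a c := (u (a + 1) c + u (a - 1) c) / 2.
  pose v a c := u (a + 1) c - u (a - 1) c.
  rewrite (@eq_walk _ _ (fun a c => avg a c + (p - 1 / 2) * v a c)); last first.
    by move=> a c; rewrite /step /avg /v /=; field.
  rewrite walkD; apply: addr_ge0; last apply: mulr_ge0; last 2 first.
  - lra.
  - apply: walk_odd_ge0 => // a c; rewrite /v; first by rewrite !uodd2; ring.
    by have := usm a c; lra.
  apply: IHs => // a c; rewrite /avg.
  - have -> : - a + 1 = - (a - 1) by ring.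
    have -> : - a - 1 = - (a + 1) by ring.
    by rewrite !uodd1; field.
  - by rewrite !uodd2; field.
  - by have := usm (a + 1) c; have := usm (a - 1) c; rewrite addrK subrK; lra.
pose avg a c := (u a (c + 1) + u a (c - 1)) / 2.
pose v a c := u a (c + 1) - u a (c - 1).
rewrite (@eq_walk _ _ (fun a c => avg a c + (p - 1 / 2) * v a c)); last first.
  by move=> a c; rewrite /step /avg /v /=; field.
rewrite walkD; apply: addr_ge0; last apply: mulr_ge0; last 2 first.
- lra.
- rewrite walk_swap; apply: walk_odd_ge0.
  + by rewrite /biased all_map.
  + by move=> a c; rewrite /v !uodd1; ring.
  + by move=> a c; rewrite /v; have := usm c a; lra.
apply: IHs => // a c; rewrite /avg.
- by rewrite !uodd1; field.
- have -> : - c + 1 = - (c - 1) by ring.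
  have -> : - c - 1 = - (c + 1) by ring.
  by rewrite !uodd2; field.
- by have := usm a (c + 1); have := usm a (c - 1); rewrite addrK subrK; lra.
Qed.

Lemma walk_abs_sub_le s : biased s ->
  walk s (fun a c => `|a - c|) <= walk s (fun a c => `|a + c|).
Proof.
move=> bs; pose u (a c : R) := `|a + c| + (-1) * `|a - c|.
suff: 0 <= walk s u by rewrite walkD mulN1r subr_ge0.
apply: walk_supermodular_ge0 => // a c; rewrite /u.
- rewrite (addrC (- a) c) -(normrN (- a - c)) opprB opprK (addrC c a) distrC.
  ring.
- by rewrite opprK; ring.
have -> : a + 1 + (c - 1) = a + c by ring.
have -> : a - 1 + (c + 1) = a + c by ring.
have -> : a + 1 - (c - 1) = a - c + 2 by ring.
have -> : a - 1 - (c + 1) = a - c - 2 by ring.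
have -> : a + 1 + (c + 1) = a + c + 2 by ring.
have -> : a - 1 + (c - 1) = a + c - 2 by ring.
have -> : a + 1 - (c + 1) = a - c by ring.
have -> : a - 1 - (c - 1) = a - c by ring.
(* Supermodularity of |a + c| - |a - c| is midpoint convexity of the absolute value, at a + c and at
   a - c. *)
have cvx (z : R) : 2 * `|z| <= `|z + 2| + `|z - 2|.
  apply: le_trans (ler_normD _ _); rewrite (_ : _ + _ = 2 * z); last by ring.
  by rewrite normrM ger0_norm.
by have := cvx (a + c); have := cvx (a - c); lra.
Qed.

(** * Expectations under finite product laws *)

Section ProductExpectation.

Definition prodE n (eta : 'I_n -> 'I_2 -> R) (F : n.-tuple 'I_2 -> R) : R :=
  \sum_x (\prod_i eta i (tnth x i)) * F x.

Lemma eq_prodE n (eta : 'I_n -> 'I_2 -> R) F G : F =1 G ->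
  prodE eta F = prodE eta G.
Proof. by move=> FG; apply: eq_bigr => x _; rewrite FG. Qed.

Lemma prodE_recl n (eta : 'I_n.+1 -> 'I_2 -> R) F :
  prodE eta F = \sum_c eta ord0 c *
    prodE (fun i => eta (lift ord0 i)) (fun x => F [tuple of c :: x]).
Proof.
rewrite /prodE big_tuple_recl; apply: eq_bigr => c _.
rewrite big_distrr /=; apply: eq_bigr => x _.
rewrite big_ord_recl mulrA; congr (_ * _ * _).
by apply: eq_bigr => i _; rewrite tnthS.
Qed.

Lemma ord2E (b : 'I_2) : b = ord0 \/ b = lift ord0 ord0.
Proof. by case: b => [[|[|//]] ib]; [left|right]; apply: val_inj. Qed.

Lemma sum_label_eq (w : 'I_2 -> R) (b : 'I_2) (G : bool -> R) :
  \sum_c w c = 1 -> \sum_c w c * G (c == b) = w b * G true + (1 - w b) * G false.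
Proof.
rewrite !big_ord_recl !big_ord0 !addr0 => <-.
by case: (ord2E b) => -> /=; ring.
Qed.

Lemma prodE_walk n (eta : 'I_n -> 'I_2 -> R) (b : 'I_n -> 'I_2)
    (t : 'I_n -> bool) u : (forall i, \sum_c eta i c = 1) ->
  prodE eta (fun x => u (\sum_i if t i then sg (tnth x i == b i) else 0)
                        (\sum_i if t i then 0 else sg (tnth x i == b i))) =
  walk [seq (eta i (b i), t i) | i <- enum 'I_n] u.
Proof.
elim: n eta b t u => [|n IHn] eta b t u eta1.
  rewrite enum_ord0 /= /prodE (big_pred1 ([tuple] : 0.-tuple 'I_2)) /=; last first.
    by move=> x; rewrite [x]tuple0 /= eqxx.
  by rewrite !big_ord0 mul1r.
rewrite enum_ordSl /= -map_comp.
rewrite -(IHn (fun i => eta (lift ord0 i)) (fun i => b (lift ord0 i))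
  (fun i => t (lift ord0 i))) //.
(* The first label enters only through whether it equals [b ord0]; isolating this bit yields the two
   branches of a [step]. *)
pose G e := prodE (fun i => eta (lift ord0 i)) (fun x => u
  ((if t ord0 then sg e else 0) +
    \sum_i if t (lift ord0 i) then sg (tnth x i == b (lift ord0 i)) else 0)
  ((if t ord0 then 0 else sg e) +
    \sum_i if t (lift ord0 i) then 0 else sg (tnth x i == b (lift ord0 i)))).
rewrite prodE_recl (eq_bigr (fun c => eta ord0 c * G (c == b ord0))); last first.
  move=> c _; congr (_ * _); apply: eq_prodE => x.
  by rewrite !big_ord_recl tnth0; congr (u (_ + _) (_ + _));
    apply: eq_bigr => i _; rewrite tnthS.
rewrite sum_label_eq // /G /prodE !big_distrr -big_split /=; apply: eq_bigr => x _.
rewrite /step /=; case: (t ord0);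
  rewrite /sg !add0r ![1 + \sum_(i < n) _]addrC ![-1 + \sum_(i < n) _]addrC; ring.
Qed.

(** The label [b i] has probability at least 1/2, so the walk is biased. Indices with [t i] feed the
    first coordinate a, the others c, and the sums compared are a - c and a + c. *)
Lemma prodE_abs_le n (eta : 'I_n -> 'I_2 -> R) (b : 'I_n -> 'I_2)
    (t : 'I_n -> bool) : (forall i c, 0 <= eta i c) ->
  (forall i, \sum_c eta i c = 1) -> (forall i c, eta i c <= eta i (b i)) ->
  prodE eta (fun x => `|\sum_i sg (t i) * sg (tnth x i == b i)|) <=
  prodE eta (fun x => `|\sum_i sg (tnth x i == b i)|).
Proof.
move=> eta0 eta1 etab.
have bs : biased [seq (eta i (b i), t i) | i <- enum 'I_n].
  apply/allP => _ /mapP[i _ ->] /=.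
  have := eta1 i; rewrite !big_ord_recl big_ord0 addr0 => e1.
  have := etab i ord0; have := etab i (lift ord0 ord0).
  have := eta0 i ord0; have := eta0 i (lift ord0 ord0).
  by case: (ord2E (b i)) => ->; move=> *; lra.
have := walk_abs_sub_le bs.
rewrite -(prodE_walk b t (fun a c => `|a - c|) eta1).
rewrite -(prodE_walk b t (fun a c => `|a + c|) eta1).
congr (_ <= _); apply: eq_prodE => x; congr `|_|.
  by rewrite -sumrB; apply: eq_bigr => i _; case: (t i) => /=; ring.
by rewrite -big_split /=; apply: eq_bigr => i _; case: (t i) => /=; ring.
Qed.

End ProductExpectation.
End SignWalk.

(** * Matchings between partitions *)

Section PairBound.
Context {R : realFieldType}.

(** [B k] is the block of [k] and C0, C1 are blocks (or empty). For xi = +1/-1 the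
    left-hand side is 2n times the weight of matching C0 to {xi = 1} and C1 to
    {xi = -1}, minus n (#|C0| + #|C1|), and the sum on the right corresponds to the
    two-block partitions {B k, rest}.  The terms on the right are bounded below with
    sign + on C0 and - elsewhere; the remaining inequality holds index by index. *)
Lemma block_pair_bound_aux n (B : 'I_n -> {set 'I_n}) (C0 C1 : {set 'I_n})
    (xi : 'I_n -> R) :
  (forall i, `|xi i| <= 1) -> (forall i k, (i \in B k) = (k \in B i)) ->
  (forall k, k \in C0 -> B k = C0) -> (forall k, k \in C1 -> B k = C1) ->
  [disjoint C0 & C1] -> (#|C1| <= #|C0|)%N ->
  n%:R * (\sum_(i in C0) xi i - \sum_(i in C1) xi i) <=
  n%:R * (n%:R - #|C0|%:R - #|C1|%:R) +
  \sum_k `|\sum_i sg (i \in B k) * xi i|.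
Proof.
move=> xi1 Bsym BC0 BC1 C01 le10.
pose C := ~: (C0 :|: C1).
have disj i : (i \in C1) = (i \in C1) && (i \notin C0).
  by case: (boolP (i \in C1)) => //= iC1; rewrite (disjointFl C01 iC1).
have split3 (F : 'I_n -> R) :
    \sum_i F i = \sum_(i in C0) F i + (\sum_(i in C1) F i + \sum_(i in C) F i).
  rewrite (bigID (fun i => i \in C0)) /=; congr (_ + _).
  rewrite (bigID (fun i => i \in C1)) /=; congr (_ + _); apply: eq_bigl => i.
    by rewrite [RHS]disj andbC.
  by rewrite !inE negb_or.
pose S (D : {set 'I_n}) := \sum_(i in D) xi i.
pose T := \sum_i xi i.
have signE k : \sum_i sg (i \in B k) * xi i = 2 * S (B k) - T.
  rewrite /S /T [in RHS]big_mkcond mulr_sumr -sumrB; apply: eq_bigr => i _.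
  by case: (i \in B k) => /=; ring.
have nE : n%:R = #|C0|%:R + (#|C1|%:R + #|C|%:R) :> R.
  by have := split3 (fun _ => 1); rewrite !sumr_const card_ord.
have TE : T = S C0 + (S C1 + S C) by exact: split3.
have BC k i : k \in C -> i \in B k -> i \in C.
  rewrite !inE => /norP[k0 k1] iB; apply/norP; split; apply/negP => iC.
    by move: k0; rewrite -(BC0 i iC) -Bsym iB.
  by move: k1; rewrite -(BC1 i iC) -Bsym iB.
(* Double counting of the pairs in a common block: the whole block of an index of [C] lies in
   [C]. *)
have count : \sum_(k in C) S (B k) = \sum_(i in C) #|B i|%:R * xi i.
  rewrite /S; under eq_bigr do rewrite big_mkcond.
  rewrite exchange_big /= (bigID (fun i => i \in C)) /= [X in _ + X]big1 ?addr0.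
    apply: eq_bigr => i iC; rewrite -big_mkcondr /= sumr_const mulr_natl.
    congr (_ *+ _); apply: eq_card => k; apply/idP/idP => [/andP[_]|kB].
      by rewrite Bsym.
    by apply/andP; split; [exact: BC iC kB|rewrite Bsym].
  move=> i iC; apply: big1 => k kC.
  by case: ifP => // ikB; move: iC; rewrite (BC k i).
have cardB i : i \in C -> (#|B i|%:R <= #|C|%:R :> R).
  by move=> iC; rewrite ler_nat subset_leq_card //; apply/subsetP => j; exact: BC.
have SC1 : - #|C1|%:R <= S C1.
  rewrite -sum1_card natr_sum -sumrN; apply: ler_sum => i _.
  by have := xi1 i; rewrite ler_norml => /andP[].
have le10R : #|C1|%:R <= #|C0|%:R :> R by rewrite ler_nat.
rewrite split3.
have h0 : #|C0|%:R * (S C0 - S C1 - S C) <=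
    \sum_(k in C0) `|\sum_i sg (i \in B k) * xi i|.
  rewrite -sum1_card natr_sum mulr_suml; apply: ler_sum => k kC0.
  apply: le_trans (ler_norm _); rewrite signE (BC0 k kC0) TE; lra.
have h1 : #|C1|%:R * (S C0 - S C1 + S C) <=
    \sum_(k in C1) `|\sum_i sg (i \in B k) * xi i|.
  rewrite -sum1_card natr_sum mulr_suml; apply: ler_sum => k kC1.
  rewrite -normrN; apply: le_trans (ler_norm _).
  by rewrite signE (BC1 k kC1) TE; lra.
have h2 : #|C|%:R * T - 2 * \sum_(i in C) #|B i|%:R * xi i <=
    \sum_(k in C) `|\sum_i sg (i \in B k) * xi i|.
  rewrite -count -[#|C|%:R]sumr_const mulr_suml [2 * _]mulr_sumr -sumrB.
  apply: ler_sum => k kC; rewrite -normrN; apply: le_trans (ler_norm _).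
  by rewrite signE; lra.
(* With c0, c1, c the sizes of [C0], [C1], [C], the coefficient of [xi i] is at most c0 + c - c1 in
   absolute value, because [B i] has at most c elements and c1 <= c0. *)
have h3 : 0 <= \sum_(i in C) (#|C0|%:R + #|C|%:R - #|C1|%:R +
    (#|C1|%:R - #|C0|%:R + #|C|%:R - 2 * #|B i|%:R) * xi i).
  apply: sumr_ge0 => i iC.
  rewrite -[leLHS](subrr (#|C0|%:R + #|C|%:R - #|C1|%:R : R)) lerD2l lerNl.
  apply: le_trans (ler_norm _) _; rewrite normrN normrM.
  have B0 : 0 <= #|B i|%:R :> R by [].
  have := cardB i iC => BiC.
  apply: le_trans (_ : (#|C0|%:R + #|C|%:R - #|C1|%:R) * 1 <= _); last by rewrite mulr1.
  apply: ler_pM => //; rewrite ler_norml; apply/andP; split; lra.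
have h3E : \sum_(i in C) (#|C0|%:R + #|C|%:R - #|C1|%:R +
    (#|C1|%:R - #|C0|%:R + #|C|%:R - 2 * #|B i|%:R) * xi i) =
    #|C|%:R * (#|C0|%:R + #|C|%:R - #|C1|%:R) +
    (#|C1|%:R - #|C0|%:R + #|C|%:R) * S C - 2 * \sum_(i in C) #|B i|%:R * xi i.
  rewrite -[X in X * (_ - _) + _]sumr_const mulr_suml [_ * S C]mulr_sumr
    [2 * _]mulr_sumr -big_split -sumrB.
  by apply: eq_bigr => i _ /=; ring.
rewrite h3E in h3; rewrite -/(S C0) -/(S C1).
(* The goal is the sum of [h0], [h1], [h2], [h3] and twice [h4]. *)
have h4 : 0 <= #|C|%:R * (#|C1|%:R + S C1) by apply: mulr_ge0 => //; lra.
move: h0 h1 h2 h3 h4; rewrite TE nE.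
set a0 := \sum_(k in C0) _; set a1 := \sum_(k in C1) _; set a2 := \sum_(k in C) _.
set w := \sum_(i in C) _; lra.
Qed.

(** Exchanging [C0] and [C1] while negating [xi] preserves both sides, so the sizes may be assumed
    ordered. *)
Lemma block_pair_bound n (B : 'I_n -> {set 'I_n}) (C0 C1 : {set 'I_n})
    (xi : 'I_n -> R) :
  (forall i, `|xi i| <= 1) -> (forall i k, (i \in B k) = (k \in B i)) ->
  (forall k, k \in C0 -> B k = C0) -> (forall k, k \in C1 -> B k = C1) ->
  [disjoint C0 & C1] ->
  n%:R * (\sum_(i in C0) xi i - \sum_(i in C1) xi i) <=
  n%:R * (n%:R - #|C0|%:R - #|C1|%:R) +
  \sum_k `|\sum_i sg (i \in B k) * xi i|.
Proof.
move=> xi1 Bsym BC0 BC1 C01; have [le10|/ltnW le01] := leqP #|C1| #|C0|.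
  exact: block_pair_bound_aux.
have := @block_pair_bound_aux n B C1 C0 (fun i => - xi i); rewrite disjoint_sym.
move=> /(_ _ Bsym BC1 BC0 C01 le01); rewrite !sumrN opprK [- _ + _]addrC.
rewrite [X in n%:R * X + _]addrAC => H.
rewrite [X in _ <= _ + X](eq_bigr (fun k => `|\sum_i sg (i \in B k) * - xi i|)).
  by apply: H => i; rewrite normrN.
move=> k _; rewrite -normrN -sumrN; congr `|_|; apply: eq_bigr => i _; ring.
Qed.

End PairBound.

Section Matchings.

Lemma label_partitionP n J (x : n.-tuple 'I_J) :
  finset.partition (label_partition x) [set: 'I_n]%SET.
Proof.
apply/and3P; split.
- apply/eqP/setP => i; rewrite in_setT; apply/bigcupP.
  exists [set j | tnth x j == tnth x i]%SET; last by rewrite inE.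
  rewrite !inE; apply/andP; split; first by apply/set0Pn; exists i; rewrite inE.
  by apply/imsetP; exists (tnth x i).
- apply/trivIsetP => U V /setD1P[_ /imsetP[c _ ->]] /setD1P[_ /imsetP[c' _ ->]].
  move=> cc'; apply/pred0P => i /=; rewrite !inE.
  by apply/negP => /andP[/eqP ic /eqP ic']; move: cc'; rewrite -ic -ic' eqxx.
- by rewrite !inE eqxx.
Qed.

Lemma matching_weight_label n J (x y : n.-tuple 'I_J) :
  (\sum_i (tnth x i == tnth y i) <=
   matching_weight (label_partition x) (label_partition y))%N.
Proof.
pose U (z : n.-tuple 'I_J) c := [set i | tnth z i == c]%SET.
(* Empty label classes are not blocks; a label absent from one of the tuples contributes no
   agreement. *)
pose K := [set c | (U x c != finset.set0) && (U y c != finset.set0)]%SET.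
pose M := [set (U x c, U y c) | c in K]%SET.
have Uinj z c c' : U z c = U z c' -> U z c != finset.set0 -> c = c'.
  move=> UU /set0Pn[i]; move: UU; move=> /setP /(_ i); rewrite !inE => e /eqP ic.
  by move: e; rewrite ic eqxx => /esym/eqP.
apply: leq_trans (_ : \sum_(e in M) #|e.1 :&: e.2| <= _)%N; last first.
  apply: (@leq_bigmax_cond {set {set 'I_n} * {set 'I_n}} (matching _ _)
    (fun N => \sum_(e in N) #|e.1 :&: e.2|)%N M).
  apply/andP; split.
    apply/subsetP => e /imsetP[c]; rewrite inE => /andP[xc yc] ->.
    by rewrite !inE /= xc yc /=; apply/andP; split; apply/imsetP; exists c.
  apply/forall_inP => e /imsetP[c]; rewrite inE => /andP[xc yc] ->.
  apply/forall_inP => e' /imsetP[c']; rewrite inE => /andP[xc' yc'] -> /=.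
  by apply/implyP => /orP[] /eqP /Uinj => [/(_ xc)|/(_ yc)] ->.
rewrite big_imset /=; last first.
  by move=> c c'; rewrite inE => /andP[xc _] _ [/Uinj /(_ xc)].
rewrite (partition_big (tnth x) predT) //= [leqRHS]big_mkcond /=.
apply: leq_sum => c _; rewrite (eq_bigr (fun i => nat_of_bool (tnth y i == c))).
  rewrite -big_mkcondr /= sum1_card.
  have -> : #|[pred i | (tnth x i == c) && (tnth y i == c)]| = #|U x c :&: U y c|.
    by apply: eq_card => i; rewrite !inE.
  case: ifPn => // /negP Kc; rewrite leqn0 cards_eq0.
  apply/negPn/negP => /set0Pn[i]; rewrite !inE => /andP[ix iy]; apply: Kc.
  by rewrite inE; apply/andP; split; apply/set0Pn; exists i; rewrite inE.
by move=> i /eqP ->; rewrite eq_sym.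
Qed.

Context {R : realFieldType}.

(** The k-th absolute value is 2 w - n, with w the weight obtained from {block of k, rest}; the
    right-hand side is thus 2n times the average of these weights. *)
Lemma matching_weight_le n (A : {set {set 'I_n}}) (x : n.-tuple 'I_2) :
  finset.partition A [set: 'I_n]%SET ->
  2 * n%:R * (matching_weight A (label_partition x))%:R <=
  n%:R * n%:R +
  \sum_k `|\sum_i sg (i \in pblock A k) * sg (tnth x i == ord0)| :> R.
Proof.
move=> /and3P[/eqP coverA trivA A0].
have inA k : pblock A k \in A by rewrite pblock_mem // coverA inE.
set r := (X in _ <= X).
rewrite /matching_weight; apply: (big_ind (fun k : nat => 2 * n%:R * k%:R <= r)).
- rewrite mulr0; apply: addr_ge0; first by rewrite mulr_ge0.
  by apply: sumr_ge0.
- by move=> k l kr lr; rewrite /maxn; case: ifP.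
move=> M /andP[/subsetP subM /forall_inP injM].
pose L c := [set i | tnth x i == c]%SET.
(* Each true class lies in at most one edge, so [M] is described by the block matched to each of the
   two classes, the empty set standing for no edge. *)
pose C c := if [pick e in M | e.2 == L c] is Some e then e.1 else finset.set0.
have CB c k : k \in C c -> pblock A k = C c.
  rewrite /C; case: pickP => [e /andP[/subM]|]; last by rewrite inE.
  by rewrite inE => /andP[e1 _] _ ke; apply: def_pblock.
have C01 : [disjoint C ord0 & C (lift ord0 ord0)].
  rewrite /C; case: pickP => [e /andP[eM /eqP eL]|_]; last by rewrite -setI_eq0 set0I.
  case: pickP => [e' /andP[eM' /eqP eL']|_]; last by rewrite -setI_eq0 setI0.
  have := subM e eM; rewrite inE => /andP[eA eP].
  have := subM e' eM'; rewrite inE => /andP[eA' eP'].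
  apply: (trivIsetP trivA) => //; apply/eqP => ee'.
  have /forall_inP /(_ e' eM') := injM e eM.
  rewrite ee' eqxx /= => /eqP eqe; move: eP; rewrite eL => /setD1P[/set0Pn[i]].
  rewrite inE => /eqP i0 _; move: (eL'); rewrite -eqe eL => /setP /(_ i).
  by rewrite !inE i0.
have wc c : (\sum_(e in M | e.2 == L c) #|e.1 :&: e.2| = #|C c :&: L c|)%N.
  rewrite /C; case: pickP => [e /andP[eM /eqP eL]|noe]; last first.
    by rewrite set0I cards0 big_pred0.
  rewrite (big_pred1 e) ?eL // => e'; apply/andP/eqP => [[eM' /eqP eL']|->].
    have /forall_inP /(_ e eM) := injM e' eM'.
    by rewrite eL eL' eqxx orbT => /eqP.
  by rewrite eL eqxx.
have wM : (\sum_(e in M) #|e.1 :&: e.2| <=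
    #|C ord0 :&: L ord0| + #|C (lift ord0 ord0) :&: L (lift ord0 ord0)|)%N.
  rewrite -!wc [leqLHS](bigID (fun e => e.2 == L ord0)) /= leq_add2l.
  rewrite [leqLHS]big_mkcond [leqRHS]big_mkcond /=; apply: leq_sum => e _.
  case: (boolP (e \in M)) => //= eM; case: eqP => //= e0.
  have := subM e eM; rewrite inE => /andP[_ /setD1P[_ /imsetP[c _ ec]]].
  case: (ord2E c) ec => -> ec; last by rewrite ec eqxx.
  by case: e0.
pose xi i : R := sg (tnth x i == ord0).
have xi1 i : `|xi i| <= 1 by rewrite /xi /sg; case: ifP => _; rewrite ?normrN normr1.
have sumxi (D : {set 'I_n}) :
    \sum_(i in D) xi i = 2 * #|D :&: L ord0|%:R - #|D|%:R.
  rewrite -[#|D|%:R]sumr_const -[#|_ :&: _|%:R]sumr_const mulr_sumr.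
  rewrite [X in _ = X - _](eq_bigl (fun i => (i \in D) && (tnth x i == ord0))).
    2: by move=> i; rewrite !inE.
  rewrite [X in _ = X - _]big_mkcondr -sumrB; apply: eq_bigr => i _; rewrite /xi.
  by case: ifP => _ /=; ring.
have cardD (D : {set 'I_n}) :
    (#|D :&: L ord0| + #|D :&: L (lift ord0 ord0)| = #|D|)%N.
  rewrite -(cardsID (L ord0) D); congr (_ + _)%N; apply: eq_card => i.
  by rewrite !inE andbC; congr (_ && _); case: (ord2E (tnth x i)) => ->.
have Bsym i k : (i \in pblock A k) = (k \in pblock A i).
  by rewrite -!eq_pblock ?coverA ?inE // eq_sym.
have := block_pair_bound xi1 Bsym (CB _) (CB _) C01.
have := cardD (C (lift ord0 ord0)); move: wM.
rewrite !sumxi -(ler_nat R) natrD => wM /(congr1 (fun k => k%:R : R)).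
rewrite natrD -/r => cD1; rewrite /r.
set s := \sum_k _; set w := (\sum_(e in M) _)%N in wM *.
move=> H; apply: le_trans (_ : n%:R * (2 * (#|C ord0 :&: L ord0|%:R +
   #|C (lift ord0 ord0) :&: L (lift ord0 ord0)|%:R)) <= _).
  by rewrite mulrAC mulrC ler_wpM2l // ler_wpM2l.
by move: H; rewrite -cD1; lra.
Qed.

End Matchings.

From mathcomp Require Import all_classical all_reals all_analysis.
From mathcomp Require Import measurable_realfun.
Local Open Scope classical_set_scope.
Local Open Scope ring_scope.

(** * Truncated moments of the binomial law *)

Section ProdEMoments.
Context {R : realFieldType}.

Lemma le_prodE n (eta : 'I_n -> 'I_2 -> R) (F G : n.-tuple 'I_2 -> R) :
  (forall i c, 0 <= eta i c) -> (forall x, F x <= G x) ->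
  prodE eta F <= prodE eta G.
Proof.
by move=> eta0 FG; apply: ler_sum => x _; rewrite ler_wpM2l ?prodr_ge0.
Qed.

Lemma prodED n (eta : 'I_n -> 'I_2 -> R) (F G : n.-tuple 'I_2 -> R) :
  prodE eta (fun x => F x + G x) = prodE eta F + prodE eta G.
Proof. by rewrite -big_split /=; apply: eq_bigr => x _; rewrite mulrDr. Qed.

Lemma prodEZ n (eta : 'I_n -> 'I_2 -> R) k (F : n.-tuple 'I_2 -> R) :
  prodE eta (fun x => k * F x) = k * prodE eta F.
Proof. by rewrite /prodE mulr_sumr; apply: eq_bigr => x _; rewrite mulrCA. Qed.

Lemma prodE_sum n (eta : 'I_n -> 'I_2 -> R) (I : finType) (F : I -> n.-tuple 'I_2 -> R) :
  prodE eta (fun x => \sum_i F i x) = \sum_i prodE eta (F i).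
Proof. by rewrite exchange_big; apply: eq_bigr => x _; rewrite mulr_sumr. Qed.

Lemma prodE_prod n (eta g : 'I_n -> 'I_2 -> R) :
  prodE eta (fun x => \prod_i g i (tnth x i)) = \prod_i \sum_c eta i c * g i c.
Proof.
by rewrite -sum_tuple_prod; apply: eq_bigr => x _; rewrite big_split.
Qed.

Lemma prodE_cst n (eta : 'I_n -> 'I_2 -> R) k :
  (forall i, \sum_c eta i c = 1) -> prodE eta (fun=> k) = k.
Proof.
move=> eta1; rewrite (@eq_prodE _ _ _ _ (fun x => k * \prod_(i < n) 1)).
  rewrite prodEZ (prodE_prod _ (fun _ _ => 1)) big1 ?mulr1 // => i _.
  by under eq_bigr do rewrite mulr1.
by move=> x; rewrite prodr_const expr1n mulr1.
Qed.

(** Second moments add up because each cross term of the induction carries the zero mean of the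
    remaining sum. *)
Lemma prodE_centered n (eta g : 'I_n -> 'I_2 -> R) :
  (forall i, \sum_c eta i c = 1) -> (forall i, \sum_c eta i c * g i c = 0) ->
  prodE eta (fun x => \sum_i g i (tnth x i)) = 0 /\
  prodE eta (fun x => (\sum_i g i (tnth x i)) ^+ 2) =
    \sum_i \sum_c eta i c * g i c ^+ 2.
Proof.
elim: n eta g => [|n IHn] eta g eta1 g0.
  split; rewrite ?big_ord0 -[RHS](@prodE_cst _ eta 0) //; apply: eq_prodE => x;
    by rewrite big_ord0 ?expr0n.
pose eta' (i : 'I_n) := eta (lift ord0 i); pose g' (i : 'I_n) := g (lift ord0 i).
have [M1 M2] := IHn eta' g' (fun i => eta1 _) (fun i => g0 _).
rewrite !prodE_recl; split.
  rewrite -[RHS](g0 ord0); apply: eq_bigr => c _; congr (_ * _).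
  rewrite (@eq_prodE _ _ _ _ (fun x => g ord0 c + \sum_i g' i (tnth x i))).
    by rewrite prodED M1 addr0 prodE_cst // => i; exact: eta1.
  by move=> x; rewrite big_ord_recl tnth0; congr (_ + _);
    apply: eq_bigr => i _; rewrite tnthS.
rewrite [in RHS]big_ord_recl -/eta' -M2 -[X in _ + X]mul1r -[X in _ + X * _](eta1 ord0).
rewrite mulr_suml -big_split; apply: eq_bigr => c _ /=; rewrite -mulrDr; congr (_ * _).
rewrite (@eq_prodE _ _ _ _ (fun x => g ord0 c ^+ 2 + (2 * g ord0 c *
    (\sum_i g' i (tnth x i)) + (\sum_i g' i (tnth x i)) ^+ 2))).
  by rewrite prodED prodED prodEZ M1 mulr0 add0r prodE_cst // => i; exact: eta1.
move=> x; rewrite big_ord_recl tnth0.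
rewrite (eq_bigr (fun i => g' i (tnth x i))); first by ring.
by move=> i _; rewrite tnthS.
Qed.

End ProdEMoments.

Section BinomialBound.
Context {R : realType}.
Variables (n : nat) (r : R).

(** Label [ord0] stands for a correct classification and the other label for an
    error, so that the number D of errors satisfies [exc x] = 2 D - n. *)
Definition errE : (n.-tuple 'I_2 -> R) -> R :=
  prodE (fun _ c => if c == ord0 then 1 - r else r).

Definition exc (x : n.-tuple 'I_2) : R := \sum_i - sg (tnth x i == ord0).

Let eta0 (i : 'I_n) (c : 'I_2) : 0 <= r -> r <= 1 / 2 ->
  0 <= (if c == ord0 then 1 - r else r).
Proof. by case: ifP => _ //; lra. Qed.

Let eta1 (i : 'I_n) : \sum_(c < 2) (if c == ord0 then 1 - r else r) = 1.
Proof. by rewrite !big_ord_recl big_ord0 /=; ring. Qed.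

(** |v| = 2 v^+ - v, and [exc] has mean - n (1 - 2 r). *)
Lemma errE_exc_abs : errE (fun x => `|exc x|) =
  2 * errE (fun x => Num.max (exc x) 0) + n%:R * (1 - 2 * r).
Proof.
have [M _] := @prodE_centered _ n (fun _ c => if c == ord0 then 1 - r else r)
  (fun _ c => - sg (c == ord0) + (1 - 2 * r)) eta1
  (fun i => ltac:(rewrite !big_ord_recl big_ord0 /=; ring)).
rewrite -[RHS]addr0 -[X in _ + X]oppr0 -[X in _ - X]M.
rewrite -[n%:R * _](prodE_cst (n%:R * (1 - 2 * r)) eta1).
rewrite -[X in _ = _ + X]mulN1r /errE -!prodEZ -!prodED.
apply: eq_prodE => x; rewrite big_split /= sumr_const card_ord -/(exc x).
rewrite -[(1 - _) *+ _]mulr_natl; case: (lerP 0 (exc x)) => e0.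
  by rewrite ger0_norm //; ring.
by rewrite ltr0_norm //; ring.
Qed.

Lemma errE_pos_le_sqrt : (2 <= n)%N -> 0 <= r -> r <= 1 / 2 ->
  errE (fun x => Num.max (exc x) 0) <= Num.sqrt n%:R.
Proof.
move=> n_ge2 r0 r2; pose g (i : 'I_n) (c : 'I_2) : R := - sg (c == ord0) + (1 - 2 * r).
have [M V] := @prodE_centered _ n (fun _ c => if c == ord0 then 1 - r else r)
  g eta1 (fun i => ltac:(rewrite /g !big_ord_recl big_ord0 /=; ring)).
set t : R := Num.sqrt n%:R.
have t0 : 0 < t by rewrite sqrtr_gt0 ltr0n ltnW.
have t2 : t ^+ 2 = n%:R by rewrite sqr_sqrtr.
(* The centred sum z dominates [exc] since r <= 1/2, and z <= z^2 / (2 t) + t / 2 by AM-GM. With t =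
   sqrt n and a variance of at most n, each term has expectation at most t / 2. *)
apply: le_trans (_ : errE (fun x =>
  (2 * t)^-1 * (\sum_i g i (tnth x i)) ^+ 2 + t / 2) <= _).
  apply: le_prodE => [i c|x]; first exact: eta0.
  have exg : exc x <= \sum_i g i (tnth x i).
    by apply: ler_sum => i _; rewrite /g; lra.
  set z := \sum_i _ in exg *; have tz : z <= (2 * t)^-1 * z ^+ 2 + t / 2.
    rewrite -(ler_pM2l (_ : 0 < 2 * t)); last by rewrite mulr_gt0.
    rewrite mulrDr mulrA divff ?mul1r; last by rewrite mulf_neq0 // lt0r_neq0.
    have -> : 2 * t * (t / 2) = t ^+ 2 by field.
    by have := sqr_ge0 (z - t); rewrite sqrrB; nra.
  rewrite ge_max (le_trans exg tz) /=; apply: addr_ge0; last by lra.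
  by apply: mulr_ge0; rewrite ?sqr_ge0 // invr_ge0; lra.
rewrite /errE prodED prodEZ V prodE_cst //.
have -> : \sum_i \sum_c (if c == ord0 then 1 - r else r) * g i c ^+ 2 =
    n%:R * (4 * r * (1 - r)).
  rewrite (eq_bigr (fun _ => 4 * r * (1 - r))) ?sumr_const ?card_ord ?mulr_natl //.
  by move=> i _; rewrite /g !big_ord_recl big_ord0 /=; ring.
rewrite -t2.
have -> : (2 * t)^-1 * (t ^+ 2 * (4 * r * (1 - r))) = t / 2 * (4 * r * (1 - r)).
  by field; exact: lt0r_neq0.
have : t / 2 * (4 * r * (1 - r)) <= t / 2 * 1.
  by apply: ler_wpM2l; [lra|have := sqr_ge0 (2 * r - 1); nra].
lra.
Qed.

Lemma errE_pos_le_exp s : 0 <= r -> r <= 1 / 2 -> 0 < s ->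
  errE (fun x => Num.max (exc x) 0) <=
  s^-1 * ((1 - r) * expR (- s) + r * expR s) ^+ n.
Proof.
move=> r0 r2 s0; apply: le_trans (_ : errE (fun x => s^-1 *
  \prod_i (expR (- (s * sg (tnth x i == ord0))))) <= _).
  apply: le_prodE => [i c|x]; first exact: eta0.
  rewrite ge_max; apply/andP; split; last first.
    by apply: mulr_ge0; [rewrite invr_ge0 ltW|apply: prodr_ge0 => i _; exact: expR_ge0].
  rewrite -expR_sum sumrN -mulr_sumr mulrC ler_pdivlMr // -mulrN -sumrN -/(exc x).
  rewrite mulrC; apply: le_trans (expR_ge1Dx _); lra.
rewrite /errE prodEZ (prodE_prod _ (fun _ c => expR (- (s * sg (c == ord0))))).
rewrite (eq_bigr (fun=> (1 - r) * expR (- s) + r * expR s)).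
  by rewrite prodr_const card_ord.
by move=> i _; rewrite !big_ord_recl big_ord0 /= mulr1 mulrN1 opprK addr0.
Qed.

(** Since 1 - 2 eps = 2 r, the factor r cancels and sqrt(pi n / 2) remains, which is at least sqrt n
    because pi >= 2. *)
Lemma errE_pos_le_alpha_snd : (2 <= n)%N -> 0 < r -> r <= 1 / 2 ->
  errE (fun x => Num.max (exc x) 0) <=
  n%:R * (2 * alpha_snd n (1 / 2 - r)) * r.
Proof.
move=> n_ge2 rgt0 r2; apply: le_trans (errE_pos_le_sqrt n_ge2 (ltW rgt0) r2) _.
rewrite /alpha_snd.
have n0 : 0 < n%:R :> R by rewrite ltr0n ltnW.
have -> : 1 - 2 * (1 / 2 - r) = 2 * r by field.
have -> : n%:R * (2 * ((2 * r)^-1 * Num.sqrt (pi / (2 * n%:R)))) * r =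
    n%:R * Num.sqrt (pi / (2 * n%:R)) :> R by field; exact: lt0r_neq0.
rewrite -[X in X * _](sqr_sqrtr (ltW n0)) expr2 -mulrA ler_peMr ?sqrtr_ge0 //.
rewrite -sqrtrM // -[leLHS]sqrtr1 ler_wsqrtr //.
have -> : n%:R * (pi / (2 * n%:R)) = pi / 2 :> R by field; exact: lt0r_neq0.
by have := @pi_ge2 R; lra.
Qed.

Lemma errE_pos_le_alpha_fst : (2 <= n)%N -> 0 < r -> r < 1 / 2 ->
  errE (fun x => Num.max (exc x) 0) <=
  n%:R * (2 * fine (alpha_fst n (1 / 2 - r))) * r.
Proof.
move=> n_ge2 rgt0 rlt2; rewrite /alpha_fst ifF; last by apply/negP => /eqP; lra.
have n0 : 0 < n%:R :> R by rewrite ltr0n ltnW.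
have -> : 1 + 2 * (1 / 2 - r) = 2 * (1 - r) by field.
have -> : 1 - 2 * (1 / 2 - r) = 2 * r by field.
have -> : 2 * (1 - r) / (2 * r) = (1 - r) / r by field; exact: lt0r_neq0.
have -> : 1 - 4 * (1 / 2 - r) ^+ 2 = 4 * r * (1 - r) by field.
(* For q = exp s one has 1 - r = r q^2: the two terms of (1 - r) / q + r q coincide, and 4 r (1 - r)
   is the square of 2 r q, which turns the real power into a natural one. *)
pose s := ln ((1 - r) / r) / 2.
have q1 : 1 < (1 - r) / r by rewrite ltr_pdivlMr //; lra.
have s0 : 0 < s by rewrite divr_gt0 // ln_gt0.
have -> : ln ((1 - r) / r) = 2 * s by rewrite /s; field.
have e2 : expR s ^+ 2 = (1 - r) / r.
  rewrite -expRM_natl (_ : 2%:R * s = ln ((1 - r) / r)); last by rewrite /s; field.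
  by rewrite lnK // posrE; lra.
set q := expR s; have q0 : 0 < q := expR_gt0 s.
have rq : 1 - r = r * q ^+ 2 by rewrite e2; field; exact: lt0r_neq0.
have p0 : 0 <= 2 * r * q by rewrite !mulr_ge0 // ltW.
have -> : 4 * r * (1 - r) = (2 * r * q) ^+ 2 by rewrite rq; ring.
have -> : ((2 * r * q) ^+ 2) `^ ((n%:R - 2) / 2) = (2 * r * q) ^+ (n - 2).
  rewrite -powR_mulrn // -powRrM -powR_mulrn // natrB //.
  by congr (_ `^ _); field.
apply: le_trans (errE_pos_le_exp (ltW rgt0) (ltW rlt2) s0) _; rewrite /= expRN -/q.
have -> : (1 - r) * q^-1 + r * q = 2 * r * q by rewrite rq; field; exact: lt0r_neq0.
(* From here the two sides are equal: two of the n factors 2 r q supply 4 r (1 - r). *)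
rewrite -{1}(subnK n_ge2) exprD.
rewrite le_eqVlt; apply/orP; left; apply/eqP.
set p := _ ^+ (n - 2).
have -> : n%:R * (2 * (2 * (2 * (1 - r)) * (p / (n%:R * (2 * s))))) * r =
   s^-1 * (p * (4 * r * (1 - r))) by field; rewrite !lt0r_neq0.
by rewrite rq; ring.
Qed.

Lemma errE_pos_le_alpha : (2 <= n)%N -> 0 <= r -> r <= 1 / 2 ->
  errE (fun x => Num.max (exc x) 0) <= n%:R * alpha n (1 / 2 - r) * r.
Proof.
move=> n_ge2 r0 r2; have n0 : 0 < n%:R :> R by rewrite ltr0n ltnW.
(* For r = 0 a pattern with an error has weight 0, and the errorless one has [exc] equal to - n. *)
have [r_eq0|rN0] := eqVneq r 0.
  rewrite {2}r_eq0 mulr0 /errE /prodE; apply: sumr_le0 => x _.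
  have [/forallP x0|/forallPn[i xi]] := boolP [forall i, tnth x i == ord0].
    have -> : exc x = - n%:R.
      rewrite /exc (eq_bigr (fun=> -1)) => [|i _]; last by rewrite /sg x0.
      by rewrite sumrN sumr_const card_ord.
    by rewrite max_r ?mulr0 // lerNl oppr0.
  by rewrite (bigD1 i) //= (negbTE xi) r_eq0 !mul0r.
have rgt0 : 0 < r by rewrite lt0r rN0.
rewrite /alpha ifF; last by apply/negP => /eqP; lra.
(* Here eps = 0: the first term is +oo and the minimum is the second. *)
have [r_half|rN2] := eqVneq r (1 / 2).
  have := errE_pos_le_alpha_snd n_ge2 rgt0 r2.
  have -> : 1 / 2 - r = 0 by rewrite r_half subrr.
  by rewrite /alpha_fst eqxx min_r ?leey.
have rlt2 : r < 1 / 2 by rewrite lt_neqAle rN2.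
case: (leP (alpha_fst n (1 / 2 - r)) (alpha_snd n (1 / 2 - r))%:E) => _.
  exact: errE_pos_le_alpha_fst.
exact: errE_pos_le_alpha_snd.
Qed.

Lemma errE_loss_ge : (2 <= n)%N -> 0 <= r -> r <= 1 / 2 ->
  (1 - alpha n (1 / 2 - r)) * r <=
  errE (fun x => 1 / 2 - (2 * n%:R)^-1 * `|\sum_i sg (tnth x i == ord0)|).
Proof.
move=> n_ge2 r0 r2; have n0 : 0 < n%:R :> R by rewrite ltr0n ltnW.
rewrite /errE (@eq_prodE _ _ _ _ (fun x => 1 / 2 + (- (2 * n%:R)^-1) * `|exc x|)).
  rewrite prodED prodE_cst // prodEZ; have := errE_exc_abs; rewrite {1}/errE => ->.
  set E := errE _.
  have -> : 1 / 2 + - (2 * n%:R)^-1 * (2 * E + n%:R * (1 - 2 * r)) = r - E / n%:R.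
    by field; exact: lt0r_neq0.
  have : E / n%:R <= alpha n (1 / 2 - r) * r.
    rewrite ler_pdivrMr // [leRHS]mulrC mulrA; exact: errE_pos_le_alpha.
  by rewrite [(1 - _) * r]mulrBl [1 * r]mul1r => H; rewrite lerD2l lerN2.
by move=> x; rewrite /exc sumrN normrN mulNr.
Qed.

End BinomialBound.

(** * Measures on tuples *)

Section IndicExtension.
Import HBNNSimple.
Context {R : realType} d (T : measurableType d).

Section OneSide.
Context d1 (Om : measurableType d1) (P : {measure set Om -> \bar R}).
Variables (Y : Om -> T) (W : Om -> R).
Hypotheses (mY : measurable_fun setT Y) (mW : measurable_fun setT W).
Hypothesis W0 : forall w, 0 <= W w.

Lemma integral_weighted_nnsfun (g : {nnsfun T >-> R}) :
  (\int[P]_w (W w * g (Y w))%:E =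
   \sum_(x \in range g) x%:E * \int[P]_w (W w * \1_(g @^-1` [set x]) (Y w))%:E)%E.
Proof.
(* On the fibre x is a value of [g], hence nonnegative; off the fibre the indicator vanishes. *)
have g0 x w : 0 <= x * \1_(g @^-1` [set x]) (Y w).
  rewrite indicE; case: (boolP (Y w \in _)) => [|_]; last by rewrite mulr0.
  by rewrite inE /= => <-; rewrite mulr1.
have mg x : measurable_fun setT (fun w => W w * \1_(g @^-1` [set x]) (Y w)).
  apply: measurable_funM => //; apply: measurableT_comp => //.
under eq_integral => w _ do rewrite (fimfunE g (Y w)) mulr_fsumr -fsumEFin //.
rewrite ge0_integral_fsum //.
- apply: eq_fsbigr => x; rewrite inE /= => -[y _ gx].
  under eq_integral do rewrite mulrCA EFinM.
  rewrite ge0_integralZl_EFin //.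
  + by move=> w _; rewrite lee_fin mulr_ge0.
  + exact/measurable_EFinP.
  + by rewrite -gx.
- move=> x; apply/measurable_EFinP; under eq_fun do rewrite mulrCA.
  exact: measurable_funM.
- by move=> x w _; rewrite lee_fin mulr_ge0.
Qed.

Lemma integral_weighted_approx (phi : T -> R)
    (mphi : measurable_fun setT (EFin \o phi)) : (forall y, 0 <= phi y) ->
  (\int[P]_w (W w * phi (Y w))%:E =
   limn (fun k => \int[P]_w (W w * nnsfun_approx measurableT mphi k (Y w))%:E))%E.
Proof.
move=> phi0; rewrite -monotone_convergence //.
- apply: eq_integral => w _; apply/esym/cvg_lim => //.
  rewrite EFinM; under eq_fun do rewrite EFinM.
  apply: cvgeZl => //; apply: (@cvg_nnsfun_approx _ _ _ _ measurableT _ mphi) => //.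
  by move=> y _; rewrite /= lee_fin.
- move=> k; apply/measurable_EFinP; apply: measurable_funM => //.
  exact: measurableT_comp.
- by move=> k w _; rewrite lee_fin mulr_ge0.
- move=> w _ k l kl; rewrite lee_fin ler_wpM2l //.
  by have /lefP := nd_nnsfun_approx measurableT mphi kl.
Qed.

End OneSide.

(** The equality passes from indicators to simple functions and then to monotone limits. Two spaces
    are allowed because it will compare an integral over [Om], weighted by the other coordinates,
    with one over the observation space, weighted by a density. *)
Lemma eq_integral_weighted d1 (Om1 : measurableType d1) (P1 : {measure set Om1 -> \bar R})
    d2 (Om2 : measurableType d2) (P2 : {measure set Om2 -> \bar R})
    (Y1 : Om1 -> T) (W1 : Om1 -> R) (Y2 : Om2 -> T) (W2 : Om2 -> R) :
  measurable_fun setT Y1 -> measurable_fun setT W1 -> (forall w, 0 <= W1 w) ->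
  measurable_fun setT Y2 -> measurable_fun setT W2 -> (forall w, 0 <= W2 w) ->
  (forall A, measurable A -> \int[P1]_w (W1 w * \1_A (Y1 w))%:E =
                             \int[P2]_w (W2 w * \1_A (Y2 w))%:E)%E ->
  forall phi : T -> R, measurable_fun setT phi -> (forall y, 0 <= phi y) ->
  (\int[P1]_w (W1 w * phi (Y1 w))%:E = \int[P2]_w (W2 w * phi (Y2 w))%:E)%E.
Proof.
move=> mY1 mW1 W10 mY2 mW2 W20 eqA phi /measurable_EFinP mphi phi0.
rewrite !(integral_weighted_approx _ _ _ _ mphi) //; congr (limn _).
apply/funext => k; rewrite !integral_weighted_nnsfun //.
by apply: eq_fsbigr => x _; rewrite eqA.
Qed.

End IndicExtension.

Section DensityMeasure.
Context {R : realType} d (T : measurableType d) (mu : {measure set T -> \bar R}).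
Variable f : T -> \bar R.
Hypotheses (mf : measurable_fun setT f) (f0 : forall x, (0 <= f x)%E).

Definition density_measure (A : set T) : \bar R := (\int[mu]_(x in A) f x)%E.

Let density_measure0 : density_measure set0 = 0%E.
Proof. exact: integral_set0. Qed.

Let density_measure_ge0 A : (0 <= density_measure A)%E.
Proof. by apply: integral_ge0 => x _; exact: f0. Qed.

Let density_measure_sigma_additive : semi_sigma_additive density_measure.
Proof. exact: semi_sigma_additive_nng_induced. Qed.

Definition density_measure_of : {measure set T -> \bar R} :=
  HB.pack density_measure
   (isMeasure.Build _ _ _ density_measure density_measure0 density_measure_ge0
     density_measure_sigma_additive).
End DensityMeasure.

Section Boxes.
Context {R : realType} d (T : measurableType d) (n : nat).

Definition box (A : 'I_n -> set T) : set (n.-tuple T) :=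
  [set y | forall i, A i (tnth y i)].

Lemma measurable_box A : (forall i, measurable (A i)) -> measurable (box A).
Proof.
move=> mA; have -> : box A = \bigcap_(i in [set: 'I_n]) ((@tnth n T)^~ i @^-1` A i).
  by apply/seteqP; split => [y Ay i _|y Ay i]; [exact: Ay|exact: (Ay i I)].
apply: fin_bigcap_measurable => // i _.
by rewrite -[X in measurable X]setTI; exact: measurable_tnth.
Qed.

Lemma tuple_measure_unique (m1 m2 : {measure set (n.-tuple T) -> \bar R}) :
  (forall A, (forall i, measurable (A i)) -> m1 (box A) = m2 (box A)) ->
  (m1 setT < +oo)%E -> forall B, measurable B -> m1 B = m2 B.
Proof.
move=> m12 m1oo B mB; pose G := [set box A | A in [set A | forall i, measurable (A i)]].
have boxT : box (fun=> setT) = setT by apply/seteqP; split.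
have GT : G setT by exists (fun=> setT).
apply: (measure_unique G (fun=> setT)) => //.
- apply/seteqP; split; last first.
    apply: smallest_sub; first exact: sigma_algebra_measurable.
    by move=> _ [A mA <-]; exact: measurable_box.
  apply: smallest_sub; first exact: smallest_sigma_algebra.
  rewrite -bigcup_seq /=; apply: bigcup_sub => i _ _ [A mA <-].
  (* A one-coordinate cylinder is the box whose other sides are full. *)
  apply: sub_sigma_algebra; exists (fun j => if j == i then A else setT).
    by move=> j; case: ifP.
  apply/seteqP; split => y /=.
    by move=> /(_ i); rewrite eqxx.
  by move=> [_ Ay] j; case: eqP => // ->.
- move=> _ _ [A mA <-] [A' mA' <-]; exists (fun i => A i `&` A' i).
    by move=> i; exact: measurableI.
  apply/seteqP; split => y /=; first by move=> H; split => i; case: (H i).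
  by case=> yA yA' i.
- by rewrite bigcup_const.
- by move=> _ [A mA <-]; exact: m12.
Qed.
End Boxes.

(** * Conditional law of the labels *)

Section FiniteFibers.
Context {R : realType} d (Om : measurableType d) (P : probability Om R) (K : finType).
Variable V : Om -> K.
Hypothesis mV : forall k, measurable (V @^-1` [set k]).

Lemma measure_fibers (B : set Om) : measurable B ->
  P B = (\sum_k P (B `&` V @^-1` [set k]))%E.
Proof.
move=> mB; have PE A : measurable A -> P A = (\int[P]_w (\1_A w)%:E)%E.
  by move=> mA; rewrite integral_indic // setIT.
rewrite PE // (eq_bigr _ (fun k _ => PE _ (measurableI _ _ mB (mV k)))).
rewrite -ge0_integral_sum //.
- apply: eq_integral => w _; rewrite (bigD1 (V w)) //= big1 ?addr0 => [|k kV].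
    by rewrite indicI /= [X in _ * X]indicE mem_set ?mulr1 ?adde0.
  by rewrite indicI /= [X in _ * X]indicE memNset ?mulr0 //=; apply/nesym/eqP.
- by move=> k; apply/measurable_EFinP; apply: measurable_indic; exact: measurableI.
Qed.

End FiniteFibers.

Section HmmLaw.
Context {R : realType} {T : ptopologicalType}.
Context {L : {sigma_finite_measure set (borel T) -> \bar R}} {J : nat}.
Context {theta : param L J.+1} {d : measure_display} {Om : measurableType d}.
Context {P : probability Om R} {X : nat -> Om -> 'I_J.+1} {Y : nat -> Om -> borel T}.
Hypotheses (theta_ind : Theta_ind theta) (XY : hmm P X Y theta).

Lemma hmm_X_law n (x : nat -> 'I_J.+1) :
  P [set w | forall i, (i < n)%N -> X i w = x i] =
  (\prod_(i < n) nu theta 0 (x i))%:E.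
Proof.
case: n => [|n].
  by rewrite big_ord0 -(@probability_setT _ _ _ P); congr (P _); apply/seteqP; split.
elim: n => [|n IHn].
  rewrite big_ord1 -(hmm_init XY); congr (P _); apply/seteqP; split => w /=.
    by apply.
  by move=> Xw [|i].
rewrite big_ord_recr EFinM -IHn (hmm_markov XY n x); congr (_ * _)%E.
by rewrite -(theta_ind (x n)) mxE.
Qed.

Lemma chain_event_measurable n (x : nat -> 'I_J.+1) :
  sigma_chain X [set w | forall i, (i < n)%N -> X i w = x i].
Proof.
elim: n => [|n IHn].
  have -> : [set w | forall i, (i < 0)%N -> X i w = x i] = setT.
    by apply/seteqP; split.
  exact: (@measurableT _ (g_sigma_algebraType _)).
have -> : [set w | forall i, (i < n.+1)%N -> X i w = x i] =
    [set w | forall i, (i < n)%N -> X i w = x i] `&` X n @^-1` [set x n].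
  apply/seteqP; split => w /=.
    by move=> H; split => [i ni|]; apply: H => //; exact: ltnW.
  by move=> [H Hn] i; rewrite ltnS leq_eqVlt => /predU1P[->|/H].
apply: (@measurableI _ (g_sigma_algebraType _)) => //.
by apply: sub_sigma_algebra; exists n, (x n).
Qed.

Lemma sub_sigma_chain B : sigma_chain X B -> measurable B.
Proof.
apply: smallest_sub; first exact: sigma_algebra_measurable.
by move=> _ [i [x ->]]; exact: (hmm_X_measurable XY).
Qed.

Lemma measurable_X1n n (x : n.-tuple 'I_J.+1) :
  measurable (X1n X n @^-1` [set x]).
Proof.
have -> : X1n X n @^-1` [set x] = \bigcap_(i in [set: 'I_n]) (X i @^-1` [set tnth x i]).
  apply/seteqP; split => w /=.
    by move=> <- i _ /=; rewrite tnth_mktuple.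
  by move=> H; apply: eq_from_tnth => i; rewrite tnth_mktuple; exact: H.
by apply: fin_bigcap_measurable => // i _; exact: (hmm_X_measurable XY).
Qed.

Lemma measurable_Y1n n : measurable_fun setT (Y1n Y n).
Proof.
apply/measurable_fun_tnthP => i; apply: eq_measurable_fun (hmm_Y_measurable XY i).
by move=> w _ /=; rewrite tnth_mktuple.
Qed.

Lemma hmm_box n (x : n.-tuple 'I_J.+1) (A : 'I_n -> set (borel T)) :
  (forall i, measurable (A i)) ->
  P (X1n X n @^-1` [set x] `&` Y1n Y n @^-1` box A) =
  (\prod_i (nu theta 0 (tnth x i) *
            \int[L]_(y in A i) f theta (tnth x i) y))%:E.
Proof.
move=> mA.
pose x' i := if insub i is Some j then tnth x j else ord0.
pose A' i := if insub i is Some j then A j else setT.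
have x'E (i : 'I_n) : x' i = tnth x i by rewrite /x' valK.
have A'E (i : 'I_n) : A' i = A i by rewrite /A' valK.
pose B := [set w | forall i, (i < n)%N -> X i w = x' i].
have mB : sigma_chain X B := @chain_event_measurable n x'.
have -> : X1n X n @^-1` [set x] `&` Y1n Y n @^-1` box A =
    B `&` [set w | forall i, (i < n)%N -> A' i (Y i w)].
  apply/seteqP; split => w /= [wX wY]; split.
  - by move=> i ni; rewrite (x'E (Ordinal ni)) -wX tnth_mktuple.
  - by move=> i ni; have := wY (Ordinal ni); rewrite tnth_mktuple (A'E (Ordinal ni)).
  - by apply: eq_from_tnth => i; rewrite tnth_mktuple -x'E; exact: wX.
  - by move=> i; rewrite tnth_mktuple -A'E; exact: wY.
rewrite (hmm_emission XY n) //.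
  rewrite (eq_integral (fun=>
      (\prod_(i < n) \int[L]_(y in A i) f theta (tnth x i) y)%:E)).
    rewrite integral_cst; last exact: sub_sigma_chain.
    have PB : P B = _ := hmm_X_law n x'.
    rewrite [X in (_ * X)%E]PB -EFinM mulrC -big_split /=; congr EFin.
    by apply: eq_bigr => i _; rewrite x'E.
  move=> w; rewrite inE => Bw; congr EFin; apply: eq_bigr => i _.
  by rewrite A'E Bw // x'E.
by move=> i; rewrite /A'; case: insub.
Qed.

(** The common density of the observations when the labels are i.i.d. with law [nu]. *)
Definition mixture (y : borel T) : R := \sum_c nu theta 0 c * f theta c y.

Lemma f_integrable c : L.-integrable setT (EFin \o f theta c).
Proof.
have [mf f0 f1] := f_density theta c; apply/integrableP; split.
  exact/measurable_EFinP.
under eq_integral do rewrite /= ger0_norm //.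
by rewrite f1 ltry.
Qed.

Lemma mixture_ge0 y : 0 <= mixture y.
Proof.
apply: sumr_ge0 => c _; apply: mulr_ge0; first exact: nu_ge0.
exact: density_ge0 (f_density _ _) _.
Qed.

Lemma measurable_mixture : measurable_fun setT mixture.
Proof.
apply: measurable_sum => c; apply: measurable_funM => //.
exact: density_measurable (f_density _ _).
Qed.

Lemma mixture_integrable : L.-integrable setT (EFin \o mixture).
Proof.
rewrite (_ : EFin \o mixture = fun y => (\sum_c (nu theta 0 c)%:E * (f theta c y)%:E)%E).
  by apply: integrable_sum => // c _; apply: integrableZl => //; exact: f_integrable.
by apply/funext => y /=; rewrite /mixture -sumEFin.
Qed.

Lemma Rintegral_mixture A : measurable A ->
  \int[L]_(y in A) mixture y = \sum_c nu theta 0 c * \int[L]_(y in A) f theta c y.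
Proof.
move=> mA; have fA c : L.-integrable A (EFin \o f theta c).
  by apply: integrableS (f_integrable c).
have -> : \int[L]_(y in A) mixture y =
    fine (\sum_c \int[L]_(y in A) (nu theta 0 c * f theta c y)%:E)%E.
  rewrite /Rintegral -integral_sum //.
    by congr fine; apply: eq_integral => y _; rewrite /mixture -sumEFin.
  move=> c; under eq_fun do rewrite EFinM.
  by apply: integrableZl => //; exact: fA.
rewrite (eq_bigr (fun c => (nu theta 0 c * \int[L]_(y in A) f theta c y)%:E)).
  by rewrite sumEFin.
move=> c _; rewrite -RintegralZl // fineK // integrable_fin_num //.
by under eq_fun do rewrite EFinM; apply: integrableZl => //; exact: fA.
Qed.

End HmmLaw.
Arguments mixture {R T L J} theta y.

Lemma bounded01 {R : realType} (T : Type) (f : T -> R) (D : set T) :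
  (forall x, 0 <= f x <= 1) -> [bounded f x | x in D].
Proof.
move=> f01; exists 1; split => // M M1 x _ /=; have /andP[f0 f1] := f01 x.
by rewrite ger0_norm // (le_trans f1) // ltW.
Qed.

(** * Posterior probabilities and independence of the observations *)

Section HmmPosterior.
Context {R : realType} {T : ptopologicalType}.
Context {L : {sigma_finite_measure set (borel T) -> \bar R}}.
Context {theta : param L 2} {d : measure_display} {Om : measurableType d}.
Context {P : probability Om R} {X : nat -> Om -> 'I_2} {Y : nat -> Om -> borel T}.
Hypotheses (theta_ind : Theta_ind theta) (XY : hmm P X Y theta).

Definition joint (c : 'I_2) (y : borel T) : R := nu theta 0 c * f theta c y.

(** Where [mixture] vanishes, division by zero gives the posterior [ord0], so that
    [post] is a probability vector everywhere. *)
Definition post (c : 'I_2) (y : borel T) : R :=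
  let p := joint (lift ord0 ord0) y / mixture theta y in
  if c == ord0 then 1 - p else p.

Lemma mixture2 y : mixture theta y = joint ord0 y + joint (lift ord0 ord0) y.
Proof. by rewrite /mixture !big_ord_recl big_ord0 addr0. Qed.

Lemma joint_ge0 c y : 0 <= joint c y.
Proof. by apply: mulr_ge0; [exact: nu_ge0|exact: density_ge0 (f_density _ _) _]. Qed.

Lemma measurable_joint c : measurable_fun setT (joint c).
Proof. by apply: measurable_funM => //; exact: density_measurable (f_density _ _). Qed.

Lemma post_sum y : \sum_c post c y = 1.
Proof. by rewrite !big_ord_recl big_ord0 addr0 /post /= subrK. Qed.

(** This form of Bayes' formula holds at every point: where the mixture vanishes, so do both joint
    densities, being nonnegative with sum zero. *)
Lemma post_mixture c y : post c y * mixture theta y = joint c y.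
Proof.
have j1 : joint (lift ord0 ord0) y / mixture theta y * mixture theta y =
    joint (lift ord0 ord0) y.
  have [m0|mN0] := eqVneq (mixture theta y) 0; last by rewrite divfK.
  rewrite m0 mulr0; have := joint_ge0 ord0 y; have := joint_ge0 (lift ord0 ord0) y.
  by move: m0; rewrite mixture2; lra.
rewrite /post; case: (ord2E c) => -> /=; last exact: j1.
by rewrite mulrBl mul1r j1 mixture2 addrK.
Qed.

Lemma post01 c y : 0 <= post c y <= 1.
Proof.
have p01 : 0 <= joint (lift ord0 ord0) y / mixture theta y <= 1.
  rewrite divr_ge0 ?joint_ge0 ?mixture_ge0 //=.
  have [m0|mN0] := eqVneq (mixture theta y) 0; first by rewrite m0 invr0 mulr0.
  rewrite ler_pdivrMr ?mul1r; last by rewrite lt0r mN0 mixture_ge0.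
  by rewrite mixture2 lerDr joint_ge0.
by rewrite /post; case: ifP => _ //; move: p01 => /andP[? ?]; apply/andP; split; lra.
Qed.

Lemma measurable_post c : measurable_fun setT (post c).
Proof.
have mp : measurable_fun setT (fun y => joint (lift ord0 ord0) y / mixture theta y).
  apply: measurable_funM; first exact: measurable_joint.
  (* On nonnegative values, inversion is the power of exponent -1, also at 0. *)
  rewrite (_ : (fun y => _) = (@powR R ^~ (-1)) \o mixture theta).
    by apply: measurableT_comp; [exact: measurable_powR|exact: measurable_mixture].
  by apply/funext => y /=; rewrite powR_inv1 // mixture_ge0.
rewrite /post; case: (c == ord0) => //.
by apply: measurable_funB.
Qed.

Lemma bounded_mixture_integrable (phi : borel T -> R) : measurable_fun setT phi ->
  (forall y, 0 <= phi y <= 1) ->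
  L.-integrable setT (EFin \o (fun y => phi y * mixture theta y)).
Proof.
move=> mphi phi01; apply: le_integrable (mixture_integrable (theta := theta)) => //.
  apply/measurable_EFinP; apply: measurable_funM => //; exact: measurable_mixture.
move=> y _ /=; rewrite lee_fin; have /andP[p0 p1] := phi01 y.
rewrite !ger0_norm ?mulr_ge0 ?mixture_ge0 //.
by rewrite ler_piMl ?mixture_ge0.
Qed.

Lemma measurable_prod_comp n (phi : 'I_n -> borel T -> R) (Q : pred 'I_n) :
  (forall i, measurable_fun setT (phi i)) ->
  measurable_fun setT (fun w => \prod_(i | Q i) phi i (Y i w)).
Proof.
move=> mphi; rewrite (_ : (fun w => _) =
    fun w => \prod_i (if Q i then phi i (Y i w) else 1)).
  apply: measurable_prod => i _; case: (Q i) => //.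
  by apply: measurableT_comp => //; exact: (hmm_Y_measurable XY).
by apply/funext => w; rewrite big_mkcond.
Qed.

(** Independence is needed for functions, not only for events, because it will be applied to
    posterior probabilities. Values in [0, 1] keep all integrals finite. *)
Lemma hmm_Y_indep n (phi : 'I_n -> borel T -> R) :
  (forall i, measurable_fun setT (phi i)) -> (forall i y, 0 <= phi i y <= 1) ->
  (\int[P]_w (\prod_i phi i (Y i w))%:E =
   (\prod_i \int[L]_y (phi i y * mixture theta y))%:E)%E.
Proof.
(* Indicators are replaced by [phi i] one coordinate at a time: [k] of them are done. *)
suff indep k : forall phi : 'I_n -> borel T -> R,
    (forall i, measurable_fun setT (phi i)) -> (forall i y, 0 <= phi i y <= 1) ->
    (forall i : 'I_n, (k <= i)%N -> exists2 A, measurable A & phi i = \1_A) ->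
    (\int[P]_w (\prod_i phi i (Y i w))%:E =
     (\prod_i \int[L]_y (phi i y * mixture theta y))%:E)%E.
  by move=> mphi phi01; apply: (indep n) => // i; rewrite leqNgt ltn_ord.
have ind01 (A : set (borel T)) y : 0 <= (\1_A y : R) <= 1.
  by rewrite indicE; case: (_ \in _); rewrite /= lexx ler01.
have indicZ (A : set (borel T)) (g : borel T -> R) :
    \int[L]_y (\1_A y * g y) = \int[L]_(y in A) g y.
  rewrite [RHS]Rintegral_mkcond; apply: eq_Rintegral => y _.
  by rewrite patchE indicE; case: (_ \in _); rewrite ?mul1r ?mul0r.
elim: k => [|k IHk] {}phi mphi phi01 phiA.
  have {}phiA i : exists A, measurable A /\ phi i = \1_A.
    by have [A mA ->] := phiA i isT; exists A.
  have [A /all_and2[mA phiE]] := choice phiA.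
  have mB : measurable (Y1n Y n @^-1` box A).
    rewrite -[X in measurable X]setTI; apply: (measurable_Y1n XY) => //.
    exact: measurable_box.
  transitivity (P (Y1n Y n @^-1` box A)).
    rewrite -[X in P X]setIT -integral_indic //; apply: eq_integral => w _.
    congr EFin; rewrite indicE; case: (boolP (_ \in _)) => [|/negP nB].
      rewrite inE => wB; apply: big1 => i _; rewrite phiE indicE mem_set //.
      by have := wB i; rewrite tnth_mktuple.
    have /existsNP[i nAi] : ~ forall i, A i (Y i w).
      by move=> H; apply: nB; rewrite inE => i; rewrite tnth_mktuple.
    by rewrite (bigD1 i) //= phiE indicE memNset // mul0r.
  rewrite (measure_fibers P (measurable_X1n XY (n := n))) //.
  rewrite (eq_bigr (fun x : n.-tuple 'I_2 => (\prod_i (nu theta 0 (tnth x i) *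
    \int[L]_(y in A i) f theta (tnth x i) y))%:E)); last first.
    by move=> x _; rewrite setIC (hmm_box theta_ind XY).
  rewrite sumEFin; congr EFin.
  (* Distributivity turns the sum over label tuples into a product of one-observation mixtures. *)
  rewrite (sum_tuple_prod (fun i c => nu theta 0 c * \int[L]_(y in A i) f theta c y)).
  apply: eq_bigr => i _.
  rewrite phiE indicZ Rintegral_mixture //.
have [nk|kn] := leqP n k.
  apply: IHk => // i ki; have := ltn_ord i; rewrite ltnNge.
  by rewrite (leq_trans nk ki).
pose j := Ordinal kn.
rewrite (bigD1 j) //=; under eq_integral do rewrite (bigD1 j) //= mulrC.
set C := \prod_(i | i != j) _.
have C0 : 0 <= C.
  apply: prodr_ge0 => i _; apply: Rintegral_ge0 => y _.
  by rewrite mulr_ge0 ?mixture_ge0 //; case/andP: (phi01 i y).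
have intC (g : borel T -> R) : measurable_fun setT g -> (forall y, 0 <= g y <= 1) ->
    (\int[L]_y (C * mixture theta y * g y)%:E =
     ((\int[L]_y (g y * mixture theta y))%R * C)%:E)%E.
  move=> mg g01; rewrite mulrC -RintegralZl //; last exact: bounded_mixture_integrable.
  rewrite /Rintegral fineK; last first.
    apply: integrable_fin_num => //=; under eq_fun do rewrite EFinM.
    by apply: integrableZl => //; exact: bounded_mixture_integrable.
  by apply: eq_integral => y _; congr EFin; ring.
rewrite -intC //.
(* Coordinate j is freed: the other factors are the weight under [P], and [C] times the mixture
   density is the weight under [L]. *)
apply: (@eq_integral_weighted _ _ _ _ _ P _ _ L (Y j)
  (fun w => \prod_(i < n | i != j) phi i (Y i w)) id) => //.
- exact: (hmm_Y_measurable XY).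
- exact: measurable_prod_comp.
- by move=> w; apply: prodr_ge0 => i _; case/andP: (phi01 i (Y i w)).
- by apply: measurable_funM => //; exact: measurable_mixture.
- by move=> y; rewrite mulr_ge0 ?mixture_ge0.
- move=> A mA; rewrite intC; last 2 first.
  + exact: measurable_indic.
  + exact: ind01.
  (* With an indicator back at coordinate j, the induction hypothesis applies. *)
  pose phi' i := if i == j then \1_A else phi i.
  have phi'j : phi' j = \1_A by rewrite /phi' eqxx.
  have := IHk phi'; rewrite (bigD1 j) //= phi'j.
  rewrite [X in (_ * X)%:E](eq_bigr (fun i =>
    \int[L]_y (phi i y * mixture theta y))); last first.
    by move=> i /negbTE ij; rewrite /phi' ij.
  move=> <- //.
  + apply: eq_integral => w _; rewrite [in RHS](bigD1 j) //= phi'j mulrC.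
    by congr (_ * _)%:E; apply: eq_bigr => i /negbTE ij; rewrite /phi' ij.
  + by move=> i; rewrite /phi'; case: ifP => _ //; exact: measurable_indic.
  + by move=> i y; rewrite /phi'; case: ifP => _ //; exact: ind01.
  + move=> i ki; rewrite /phi'; case: eqP => [_|/eqP ij]; first by exists A.
    apply: phiA; rewrite ltn_neqAle ki andbT; apply: contra ij => /eqP kE.
    by apply/eqP/val_inj.
- by move=> y; case/andP: (phi01 j y).
Qed.

End HmmPosterior.
Arguments post {R T L} theta c y.

(** * Conditional expectations given the observations *)

Section HmmJoint.
Context {R : realType} {T : ptopologicalType}.
Context {L : {sigma_finite_measure set (borel T) -> \bar R}}.
Context {theta : param L 2} {d : measure_display} {Om : measurableType d}.
Context {P : probability Om R} {X : nat -> Om -> 'I_2} {Y : nat -> Om -> borel T}.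
Hypotheses (theta_ind : Theta_ind theta) (XY : hmm P X Y theta).
Variable n : nat.

Definition postY (x : n.-tuple 'I_2) (w : Om) : R :=
  \prod_i post theta (tnth x i) (Y i w).

Lemma postY01 x w : 0 <= postY x w <= 1.
Proof.
apply/andP; split.
  by apply: prodr_ge0 => i _; case/andP: (post01 (theta := theta) (tnth x i) (Y i w)).
by apply: prodr_ile1 => i _; exact: post01.
Qed.

Lemma measurable_postY x : measurable_fun setT (postY x).
Proof.
apply: (measurable_prod_comp XY (phi := fun i => post theta (tnth x i))
  xpredT).
by move=> i; exact: measurable_post.
Qed.

(** Both sides are finite measures in [B], so boxes suffice. There independence factorises the
    right-hand side, and posterior times mixture is the joint density found on the left. *)
Lemma hmm_joint (x : n.-tuple 'I_2) B : measurable B ->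
  (P (X1n X n @^-1` [set x] `&` Y1n Y n @^-1` B) =
   \int[P]_(w in Y1n Y n @^-1` B) (postY x w)%:E)%E.
Proof.
have mX := measurable_X1n XY x.
have mY : measurable_fun setT (Y1n Y n) by exact: (measurable_Y1n XY).
have mZ : measurable_fun setT (EFin \o postY x).
  exact/measurable_EFinP/measurable_postY.
have Z0 w : (0 <= (postY x w)%:E)%E by rewrite lee_fin; case/andP: (postY01 x w).
(* The measure structure of a pushforward takes the measurability proof as an
   argument, over which [pose] abstracts. *)
pose m1 : {measure set (n.-tuple (borel T)) -> \bar R} :=
  pushforward (mrestr P mX) (Y1n Y n).
pose m2 : {measure set (n.-tuple (borel T)) -> \bar R} :=
  pushforward (density_measure_of P mZ Z0) (Y1n Y n).
rewrite setIC => mB; change (m1 mY B = m2 mY B).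
apply: tuple_measure_unique mB => //; last first.
  rewrite /m1 /= /pushforward /mrestr; apply: le_lt_trans (probability_le1 P _) _.
    by rewrite preimage_setT setTI.
  by rewrite ltry.
move=> A mA; rewrite /m1 /m2 /= /pushforward /mrestr setIC (hmm_box theta_ind XY) //.
rewrite /density_measure_of /= /density_measure integral_mkcond.
have mind i : measurable_fun setT (fun y => \1_(A i) y * post theta (tnth x i) y : R).
  by apply: measurable_funM; [exact: measurable_indic|exact: measurable_post].
transitivity (\int[P]_w
    (\prod_i (\1_(A i) (Y i w) * post theta (tnth x i) (Y i w)))%:E)%E.
  rewrite (hmm_Y_indep theta_ind XY mind); last first.
    move=> i y; rewrite indicE; case: (_ \in _); rewrite ?mul1r ?mul0r ?lexx ?ler01 //.
    exact: post01.
  congr EFin; apply: eq_bigr => i _; rewrite -RintegralZl //; last first.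
    by apply: integrableS (f_integrable _) => //.
  rewrite Rintegral_mkcond; apply: eq_Rintegral => y _.
  rewrite patchE indicE -mulrA post_mixture.
  by case: (_ \in _); rewrite ?mul1r ?mul0r.
apply: eq_integral => w _; rewrite patchE big_split /=.
case: (boolP (_ \in _)) => [|/negP nB].
  rewrite inE => wB; rewrite big1 ?mul1r // => i _.
  by rewrite indicE mem_set //; have := wB i; rewrite tnth_mktuple.
have /existsNP[i nAi] : ~ forall i, A i (Y i w).
  by move=> H; apply: nB; rewrite inE => i; rewrite tnth_mktuple.
by rewrite (bigD1 i) //= indicE memNset // !mul0r.
Qed.

Section Expectation.
Context {K : finType}.
Variable H : n.-tuple (borel T) -> K.
Hypothesis mH : forall k, measurable (H @^-1` [set k]).
Variable phi : n.-tuple 'I_2 -> K -> R.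

(** The conditional expectation of [phi X (H Y)] given [Y]. *)
Definition condE (w : Om) : R :=
  prodE (fun i c => post theta c (Y i w)) (phi ^~ (H (Y1n Y n w))).

Let mHY k : measurable ((H \o Y1n Y n) @^-1` [set k]).
Proof.
rewrite comp_preimage -[X in measurable X]setTI.
by apply: (measurable_Y1n XY); [|exact: mH].
Qed.

Let ind_integrable (g : Om -> R) (A : set Om) : measurable A ->
  measurable_fun setT g -> (forall w, 0 <= g w <= 1) ->
  P.-integrable setT (EFin \o (fun w => \1_A w * g w)).
Proof.
move=> mA mg g01; apply: measurable_bounded_integrable => //.
- by rewrite (le_lt_trans (probability_le1 P _)) // ltry.
- by apply: measurable_funM => //; exact: measurable_indic.
apply: bounded01 => w; rewrite indicE.
by case: (_ \in _); rewrite ?mul1r ?mul0r ?lexx ?ler01.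
Qed.

Let condE_sum w : condE w = \sum_(v : n.-tuple 'I_2 * K)
  phi v.1 v.2 * (\1_((H \o Y1n Y n) @^-1` [set v.2]) w * postY v.1 w).
Proof.
rewrite /condE /prodE -(pair_big xpredT xpredT (fun x k => phi x k *
  (\1_((H \o Y1n Y n) @^-1` [set k]) w * postY x w))) /=.
apply: eq_bigr => x _; rewrite (bigD1 (H (Y1n Y n w))) //= [X in _ + X]big1 ?addr0.
  by rewrite indicE mem_set // mul1r mulrC.
by move=> k kH; rewrite indicE memNset ?mul0r ?mulr0 //=; exact/nesym/eqP.
Qed.

Lemma condE_integrable : P.-integrable setT (EFin \o condE).
Proof.
rewrite (_ : EFin \o condE = fun w => (\sum_(v : n.-tuple 'I_2 * K) (phi v.1 v.2)%:E *
    (\1_((H \o Y1n Y n) @^-1` [set v.2]) w * postY v.1 w)%:E)%E).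
  apply: integrable_sum => // v _; apply: integrableZl => //.
  by apply: ind_integrable; [exact: mHY|exact: measurable_postY|exact: postY01].
by apply/funext => w; rewrite /= condE_sum -sumEFin.
Qed.

(** Labels and [H] take finitely many values, so the integrand is a finite combination of indicators
    of {X = x, H(Y) = k}, and [hmm_joint] treats each of them. *)
Lemma hmm_expectation :
  fine 'E_P[fun w => phi (X1n X n w) (H (Y1n Y n w))] = \int[P]_w condE w.
Proof.
rewrite unlock /Rintegral; congr fine.
pose B (v : n.-tuple 'I_2 * K) :=
  X1n X n @^-1` [set v.1] `&` (H \o Y1n Y n) @^-1` [set v.2].
have mB v : measurable (B v).
  by apply: measurableI; [exact: (measurable_X1n XY)|exact: mHY].
transitivity (\sum_(v : n.-tuple 'I_2 * K)
    \int[P]_w ((phi v.1 v.2)%:E * (\1_(B v) w * 1)%:E))%E.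
  rewrite -integral_sum //; last first.
    move=> v; apply: integrableZl => //.
    by apply: ind_integrable => // w; rewrite ler01 lexx.
  apply: eq_integral => w _.
  under eq_bigr do rewrite -EFinM.
  rewrite sumEFin; congr EFin.
  rewrite (bigD1 (X1n X n w, H (Y1n Y n w))) //= big1 ?addr0.
    by rewrite indicE mem_set // !mulr1.
  move=> [x k] vN; rewrite indicE memNset ?mul0r ?mulr0 //= => -[/= Xx Hk].
  by move: vN; rewrite Xx Hk eqxx.
transitivity (\sum_(v : n.-tuple 'I_2 * K) \int[P]_w ((phi v.1 v.2)%:E *
    (\1_((H \o Y1n Y n) @^-1` [set v.2]) w * postY v.1 w)%:E))%E; last first.
  rewrite -integral_sum //; last first.
    move=> v; apply: integrableZl => //.
    by apply: ind_integrable; [exact: mHY|exact: measurable_postY|exact: postY01].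
  by apply: eq_integral => w _; rewrite condE_sum -sumEFin.
apply: eq_bigr => v _; rewrite !integralZl //; first congr (_ * _)%E.
- under eq_integral do rewrite mulr1.
  rewrite integral_indic // setIT; etransitivity; first exact: hmm_joint (mH v.2).
  rewrite [LHS]integral_mkcond; apply: eq_integral => w _.
  by rewrite patchE indicE; case: (_ \in _); rewrite ?mul1r ?mul0r.
- by apply: ind_integrable; [exact: mHY|exact: measurable_postY|exact: postY01].
- by apply: ind_integrable => // w; rewrite ler01 lexx.
Qed.

End Expectation.
End HmmJoint.

(** * Bayes risk and clustering risk *)

Lemma finite_expectation {R : realType} d (Om : measurableType d) (P : probability Om R)
    (K : finType) (V : Om -> K) (F : K -> R) :
  (forall k, measurable (V @^-1` [set k])) ->
  ('E_P[fun w => F (V w)] = \sum_k (F k)%:E * P (V @^-1` [set k]))%E.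
Proof.
move=> mV; rewrite unlock.
transitivity (\sum_k \int[P]_w ((F k)%:E * (\1_(V @^-1` [set k]) w)%:E))%E.
  rewrite -integral_sum //; last first.
    by move=> k; apply: integrableZl => //; exact: integrable_indic.
  apply: eq_integral => w _; under eq_bigr do rewrite -EFinM.
  rewrite sumEFin (bigD1 (V w)) //= [X in _ + X]big1 ?addr0.
    by rewrite indicE mem_set // mulr1.
  by move=> k kV; rewrite indicE memNset ?mulr0 //=; exact/nesym/eqP.
apply: eq_bigr => k _; rewrite integralZl //; last exact: integrable_indic.
by rewrite integral_indic // setIT.
Qed.

(** * Losses under a fixed posterior law *)

Section FiniteComparison.
Context {R : realType}.

Definition mismatch n (x k : n.-tuple 'I_2) : R :=
  n%:R^-1 * \sum_i (tnth k i != tnth x i)%:R.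

Lemma prodE_mismatch n (eta : 'I_n -> 'I_2 -> R) (k : n.-tuple 'I_2) :
  (forall i, \sum_c eta i c = 1) ->
  prodE eta (fun x => mismatch x k) =
  n%:R^-1 * \sum_i (1 - eta i (tnth k i)).
Proof.
move=> eta1; rewrite /mismatch prodEZ prodE_sum; congr (_ * _); apply: eq_bigr => i _.
(* A function of one label is written as a product over all labels so that [prodE_prod] applies. *)
rewrite (@eq_prodE _ _ _ _ (fun x => \prod_j
    if j == i then (tnth k i != tnth x j)%:R else 1)).
  rewrite (prodE_prod eta (fun j c => if j == i then (tnth k i != c)%:R else 1)).
  rewrite (bigD1 i) //= eqxx [X in _ * X]big1 ?mulr1; last first.
    by move=> j ij; rewrite (negbTE ij); under eq_bigr do rewrite mulr1.
  rewrite -[X in _ = X - _](eta1 i) [in RHS](bigD1 (tnth k i)) //= addrAC subrr add0r.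
  rewrite (bigD1 (tnth k i)) //= eqxx mulr0 add0r.
  by apply: eq_bigr => c kc; rewrite [_ == c]eq_sym kc /= mulr1.
by move=> x; rewrite (bigD1 i) //= eqxx big1 ?mulr1 // => j ij; rewrite (negbTE ij).
Qed.

Lemma prodE_loss_ge n (eta : 'I_n -> 'I_2 -> R) (b : n.-tuple 'I_2)
    (A : {set {set 'I_n}}) : (0 < n)%N -> (forall i c, 0 <= eta i c) ->
  (forall i, \sum_c eta i c = 1) -> (forall i c, eta i c <= eta i (tnth b i)) ->
  finset.partition A [set: 'I_n]%SET ->
  prodE eta (fun x => 1 / 2 - (2 * n%:R)^-1 * `|\sum_i sg (tnth x i == tnth b i)|) <=
  prodE eta (fun x => loss R A (label_partition x)).
Proof.
move=> n_gt0 eta0 eta1 etab partA; have n0 : 0 < n%:R :> R by rewrite ltr0n.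
apply: (@le_trans _ _ (prodE eta (fun x => 1 / 2 + (- (2 * n%:R * n%:R)^-1) *
    \sum_k `|\sum_i sg (i \in finset.pblock A k) * sg (tnth x i == ord0)|))); last first.
  apply: le_prodE => // x; rewrite /loss.
  have := @matching_weight_le R n A x partA.
  set s := \sum_k _; set w := (matching_weight _ _)%:R => ws.
  have : w <= n%:R / 2 + s / (2 * n%:R).
    rewrite -(ler_pM2l (_ : 0 < 2 * n%:R)) ?mulr_gt0 //.
    apply: le_trans ws _; rewrite le_eqVlt; apply/orP; left; apply/eqP.
    by field; exact: lt0r_neq0.
  move=> wle; have : n%:R^-1 * w <= n%:R^-1 * (n%:R / 2 + s / (2 * n%:R)).
    by rewrite ler_wpM2l // invr_ge0 ltW.
  have -> : n%:R^-1 * (n%:R / 2 + s / (2 * n%:R)) = 1 / 2 + (2 * n%:R * n%:R)^-1 * s.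
    by field; exact: lt0r_neq0.
  by rewrite mulNr; set u := _ * s; set v := _ * w; lra.
have prodE_affine k (G : n.-tuple 'I_2 -> R) :
    prodE eta (fun x => 1 / 2 + k * G x) = 1 / 2 + k * prodE eta G.
  by rewrite prodED prodE_cst // prodEZ.
rewrite prodE_affine prodE_sum.
rewrite (@eq_prodE _ _ _ _ (fun x => 1 / 2 + (- (2 * n%:R)^-1) *
   `|\sum_i sg (tnth x i == tnth b i)|)); last by move=> x; rewrite mulNr.
rewrite prodE_affine lerD2l !mulNr lerN2.
set M := prodE _ (fun x => `|\sum_i sg (tnth x i == tnth b i)|).
have -> : (2 * n%:R)^-1 * M = (2 * n%:R * n%:R)^-1 * (n%:R * M).
  by field; exact: lt0r_neq0.
rewrite ler_wpM2l ?invr_ge0 ?mulr_ge0 //.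
rewrite -[n in n%:R * M]card_ord -sum1_card natr_sum mulr_suml; apply: ler_sum => k _.
(* With two labels, the sign of x_i = 0 is the sign of x_i = b_i times that of b_i = 0; [t] absorbs
   the latter into the sign of the block. *)
rewrite mul1r; pose t i := (i \in finset.pblock A k) == (tnth b i == ord0).
rewrite (@eq_prodE _ _ _ _ (fun x => `|\sum_i sg (t i) * sg (tnth x i == tnth b i)|)).
  exact: (prodE_abs_le t eta0 eta1 etab).
move=> x; congr `|_|; apply: eq_bigr => i _; rewrite /t.
case: (_ \in _); case: (ord2E (tnth x i)) => ->; case: (ord2E (tnth b i)) => ->;
  by rewrite /sg /=; ring.
Qed.

Lemma loss_label_le n (x y : n.-tuple 'I_2) : (0 < n)%N ->
  loss R (label_partition x) (label_partition y) <=
  mismatch y x.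
Proof.
move=> n_gt0; have n0 : 0 < n%:R :> R by rewrite ltr0n.
rewrite /loss /mismatch lerBlDr -mulrDr -ler_pdivrMl ?invr_gt0 // invrK mulr1.
apply: (@le_trans _ _ (\sum_(i < n) (tnth x i != tnth y i)%:R +
    \sum_(i < n) (tnth x i == tnth y i)%:R : R)).
  rewrite -big_split /= -[n in leLHS]card_ord -sum1_card natr_sum.
  by apply: ler_sum => i _; case: (_ == _); rewrite /= ?addr0 ?add0r.
by rewrite lerD2l -natr_sum ler_nat matching_weight_label.
Qed.

End FiniteComparison.

(** * The optimal risks in the model *)

Section BayesRisk.
Context {R : realType} {T : ptopologicalType}.
Context {L : {sigma_finite_measure set (borel T) -> \bar R}}.
Context {theta : param L 2} {d : measure_display} {Om : measurableType d}.
Context {P : probability Om R} {X : nat -> Om -> 'I_2} {Y : nat -> Om -> borel T}.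
Hypotheses (theta_ind : Theta_ind theta) (XY : hmm P X Y theta).

Definition bayes (y : borel T) : 'I_2 :=
  if post theta (lift ord0 ord0) y <= post theta ord0 y
  then ord0 else lift ord0 ord0.

Lemma post_le_bayes c y : post theta c y <= post theta (bayes y) y.
Proof.
by rewrite /bayes; case: ifPn => [?|]; rewrite -?ltNge => *; case: (ord2E c) => -> //;
  exact: ltW.
Qed.

Lemma measurable_bayes c : measurable (bayes @^-1` [set c]).
Proof.
have m0 : measurable [set y | post theta (lift ord0 ord0) y <=
    post theta ord0 y].
  rewrite -[X in measurable X]setTI.
  apply: (measurable_fun_ler (measurable_post (lift ord0 ord0)) (measurable_post ord0)
    measurableT (Y := [set true])) => //.
have bE : bayes @^-1` [set ord0] = [set y | post theta (lift ord0 ord0) y <=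
    post theta ord0 y].
  by apply/seteqP; split => y; rewrite /= /bayes; case: ifP.
case: (ord2E c) => ->; first by rewrite bE.
have -> : bayes @^-1` [set lift ord0 ord0] = ~` (bayes @^-1` [set ord0]).
  by apply/seteqP; split => y /=; rewrite /bayes; case: ifP => // _ /(_ erefl).
by apply: measurableC; rewrite bE.
Qed.

Definition bayes_classifier n (y : n.-tuple (borel T)) : n.-tuple 'I_2 :=
  [tuple bayes (tnth y i) | i < n].

Lemma measurable_bayes_classifier n (x : n.-tuple 'I_2) :
  measurable (@bayes_classifier n @^-1` [set x]).
Proof.
have -> : @bayes_classifier n @^-1` [set x] = box (fun i => bayes @^-1` [set tnth x i]).
  apply/seteqP; split => y /=.
    by move=> <- i /=; rewrite tnth_mktuple.
  by move=> H; apply: eq_from_tnth => i; rewrite tnth_mktuple; exact: H.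
by apply: measurable_box => i; exact: measurable_bayes.
Qed.

(** Written through the law of a single pair, hence depending on [theta] alone. *)
Definition bayes_risk : R :=
  \sum_c nu theta 0 c * \int[L]_(y in ~` (bayes @^-1` [set c])) f theta c y.

Definition error_pattern n (x b : n.-tuple 'I_2) : n.-tuple 'I_2 :=
  [tuple if tnth x i == tnth b i then ord0 else lift ord0 ord0 | i < n].

Lemma error_pattern_eq0 n (x b : n.-tuple 'I_2) i :
  (tnth (error_pattern x b) i == ord0) = (tnth x i == tnth b i).
Proof. by rewrite tnth_mktuple; case: ifP. Qed.

(** Once the true labels are fixed, a given error pattern confines the observations to a box.
    Summing its probability over the true labels factorises into one factor [bayes_risk] or 1 -
    [bayes_risk] per index. *)
Lemma expectation_error_pattern n (F : n.-tuple 'I_2 -> R) :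
  fine 'E_P[fun w => F (error_pattern (X1n X n w) (bayes_classifier (Y1n Y n w)))] =
  errE bayes_risk F.
Proof.
pose V w := error_pattern (X1n X n w) (bayes_classifier (Y1n Y n w)).
pose A (e : n.-tuple 'I_2) (x : n.-tuple 'I_2) i := if tnth e i == ord0
  then bayes @^-1` [set tnth x i] else ~` (bayes @^-1` [set tnth x i]).
have mA e x i : measurable (A e x i).
  by rewrite /A; case: ifP => _; [|apply: measurableC]; exact: measurable_bayes.
have VE e x : V @^-1` [set e] `&` X1n X n @^-1` [set x] =
    X1n X n @^-1` [set x] `&` Y1n Y n @^-1` box (A e x).
  rewrite setIC; apply/seteqP; split => w /= [wX wV]; split => //.
    move=> i; rewrite tnth_mktuple /A -wV /V wX error_pattern_eq0 !tnth_mktuple.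
    by case: eqP => [->|H] //= H'; apply: H.
  apply: eq_from_tnth => i; have := wV i; rewrite /A /V wX !tnth_mktuple.
  case: (ord2E (tnth e i)) => -> /=; first by move=> ->; rewrite eqxx.
  by case: eqP => // -> H; case: H.
have mV e : measurable (V @^-1` [set e]).
  have -> : V @^-1` [set e] = \bigcup_(x in [set: n.-tuple 'I_2])
      (X1n X n @^-1` [set x] `&` Y1n Y n @^-1` box (A e x)).
    apply/seteqP; split => w.
      by move=> wV; exists (X1n X n w) => //; rewrite -VE.
    by case=> x _; rewrite -VE => -[].
  apply: fin_bigcup_measurable => // x _; apply: measurableI.
    exact: (measurable_X1n XY).
  rewrite -[X in measurable X]setTI; apply: (measurable_Y1n XY) => //.
  exact: measurable_box.
have risk1 : \sum_c nu theta 0 c * \int[L]_(y in bayes @^-1` [set c]) f theta c y =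
    1 - bayes_risk.
  rewrite -[X in X - _](nu_sum theta) /bayes_risk -sumrB; apply: eq_bigr => c _.
  rewrite -[X in X - _]mulr1 -mulrBr; congr (_ * _); apply/eqP.
  rewrite eq_sym subr_eq -Rintegral_setU ?setUv.
  - by rewrite /Rintegral (density_int (f_density theta c)).
  - exact: measurable_bayes.
  - by apply: measurableC; exact: measurable_bayes.
  - exact: f_integrable.
  - by apply/disj_set2P; rewrite setICr.
have PV e : P (V @^-1` [set e]) =
    (\prod_i (if tnth e i == ord0 then 1 - bayes_risk else bayes_risk))%:E.
  rewrite (measure_fibers P (measurable_X1n XY (n := n))) //.
  rewrite (eq_bigr (fun x : n.-tuple 'I_2 => (\prod_i (nu theta 0 (tnth x i) *
    \int[L]_(y in A e x i) f theta (tnth x i) y))%:E)); last first.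
    by move=> x _; rewrite VE (hmm_box theta_ind XY).
  rewrite sumEFin; congr EFin.
  rewrite (sum_tuple_prod (fun i c => nu theta 0 c * \int[L]_(y in if tnth e i == ord0
     then bayes @^-1` [set c] else ~` (bayes @^-1` [set c])) f theta c y)).
  by apply: eq_bigr => i _; case: ifP.
rewrite (finite_expectation P F mV) (eq_bigr (fun e => (F e *
    \prod_i (if tnth e i == ord0 then 1 - bayes_risk else bayes_risk))%:E)).
  by rewrite sumEFin /= /errE /prodE; apply: eq_bigr => e _; rewrite mulrC.
by move=> e _; rewrite PV.
Qed.

Section FixedSize.
Variable n : nat.
Hypothesis n_gt0 : (0 < n)%N.

Let eta w (i : 'I_n) c := post theta c (Y i w).

Let eta0 w i c : 0 <= eta w i c.
Proof. by case/andP: (post01 (theta := theta) c (Y i w)). Qed.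

Let eta1 w i : \sum_c eta w i c = 1.
Proof. exact: post_sum. Qed.

Lemma class_riskE (h : n.-tuple (borel T) -> n.-tuple 'I_2) : class_risk P X Y h =
  fine 'E_P[fun w => mismatch (X1n X n w) (h (Y1n Y n w))].
Proof.
rewrite /class_risk; congr (fine 'E_P[_]); apply/funext => w; congr (_ * _).
by apply: eq_bigr => i _; rewrite tnth_mktuple.
Qed.

Lemma bayes_classifier_admissible : classifiers (@bayes_classifier n).
Proof. exact: measurable_bayes_classifier. Qed.

Lemma class_risk_bayes : class_risk P X Y (@bayes_classifier n) = bayes_risk.
Proof.
have n0 : n%:R != 0 :> R by rewrite pnatr_eq0 -lt0n.
(* The pattern without errors: disagreements with it are exactly the errors. *)
pose z : n.-tuple 'I_2 := [tuple ord0 | i < n].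
pose G (e : n.-tuple 'I_2) : R := mismatch e z.
rewrite class_riskE (_ : (fun w => _) =
    fun w => G (error_pattern (X1n X n w) (bayes_classifier (Y1n Y n w)))).
  rewrite expectation_error_pattern /errE /G prodE_mismatch.
    rewrite (eq_bigr (fun=> bayes_risk)) => [|i _].
      by rewrite sumr_const card_ord -[bayes_risk *+ n]mulr_natl mulKf.
    by rewrite tnth_mktuple eqxx opprB addrC subrK.
  by move=> i; rewrite !big_ord_recl big_ord0 /= addr0 subrK.
apply/funext => w; congr (_ * _); apply: eq_bigr => i _.
by rewrite [tnth z i]tnth_mktuple [ord0 == _]eq_sym error_pattern_eq0 eq_sym.
Qed.

Lemma class_risk_ge_bayes (h : n.-tuple (borel T) -> n.-tuple 'I_2) :
  classifiers h -> bayes_risk <= class_risk P X Y h.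
Proof.
move=> mh; rewrite -class_risk_bayes !class_riskE.
rewrite (hmm_expectation theta_ind XY (@measurable_bayes_classifier n)).
rewrite (hmm_expectation theta_ind XY mh).
apply: le_Rintegral => //.
- exact: (condE_integrable XY (@measurable_bayes_classifier n)).
- exact: (condE_integrable XY mh).
move=> w _; rewrite /condE !prodE_mismatch; try exact: (eta1 w).
rewrite ler_wpM2l ?invr_ge0 //; apply: ler_sum => i _.
by rewrite lerD2l lerN2 !tnth_mktuple; exact: post_le_bayes.
Qed.

(** Given the observations, the likelier of two labels is wrong with probability at most 1/2. *)
Lemma bayes_risk_le_half : bayes_risk <= 1 / 2.
Proof.
have n0 : 0 < n%:R :> R by rewrite ltr0n.
rewrite -class_risk_bayes class_riskE.
rewrite (hmm_expectation theta_ind XY (@measurable_bayes_classifier n)).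
have <- : \int[P]_w (1 / 2 : R) = 1 / 2.
  by rewrite Rintegral_cst // [X in fine X]probability_setT mulr1.
apply: le_Rintegral => //.
- exact: (condE_integrable XY (@measurable_bayes_classifier n)).
- exact: finite_measure_integrable_cst.
move=> w _; rewrite /condE prodE_mismatch; last exact: (eta1 w).
rewrite ler_pdivrMl // -[n in leRHS]card_ord -sum1_card natr_sum mulr_suml.
apply: ler_sum => i _; rewrite mul1r !tnth_mktuple.
have := post_sum (theta := theta) (Y i w); rewrite !big_ord_recl big_ord0 addr0.
have := post_le_bayes ord0 (Y i w); have := post_le_bayes (lift ord0 ord0) (Y i w).
by lra.
Qed.

Lemma bayes_risk_ge0 : 0 <= bayes_risk.
Proof.
apply: sumr_ge0 => c _; apply: mulr_ge0; first exact: nu_ge0.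
by apply: Rintegral_ge0 => y _; exact: density_ge0 (f_density _ _) _.
Qed.

Lemma clust_risk_ge (g : n.-tuple (borel T) -> {set {set 'I_n}}) :
  clusterers g ->
  errE bayes_risk (fun x : n.-tuple 'I_2 =>
    1 / 2 - (2 * n%:R)^-1 * `|\sum_i sg (tnth x i == ord0)|) <= clust_risk P X Y g.
Proof.
move=> [partg mg]; rewrite -expectation_error_pattern.
(* Pairing [g] with the Bayes labels lets one statistic serve both sides, which are then compared
   for each value of the observations. *)
pose H y := (g y, bayes_classifier y).
have mH k : measurable (H @^-1` [set k]).
  have -> : H @^-1` [set k] = g @^-1` [set k.1] `&` @bayes_classifier n @^-1` [set k.2].
    by apply/seteqP; split => y /=; [move=> <-|case: k => a b [/= <- <-]].
  by apply: measurableI; [exact: mg|exact: measurable_bayes_classifier].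
pose phi1 (x : n.-tuple 'I_2) (k : {set {set 'I_n}} * n.-tuple 'I_2) : R :=
  1 / 2 - (2 * n%:R)^-1 * `|\sum_i sg (tnth x i == tnth k.2 i)|.
pose phi2 (x : n.-tuple 'I_2) (k : {set {set 'I_n}} * n.-tuple 'I_2) : R :=
  loss R k.1 (label_partition x).
rewrite (_ : (fun w => _) = fun w => phi1 (X1n X n w) (H (Y1n Y n w))); last first.
  apply/funext => w; rewrite /phi1; congr (_ - _ * `|_|).
  by apply: eq_bigr => i _; rewrite error_pattern_eq0.
rewrite (hmm_expectation theta_ind XY mH).
have -> : clust_risk P X Y g = fine 'E_P[fun w => phi2 (X1n X n w) (H (Y1n Y n w))] by [].
rewrite (hmm_expectation theta_ind XY mH).
apply: le_Rintegral => //; try exact: (condE_integrable XY mH).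
move=> w _; apply: prodE_loss_ge => //; first exact: (eta0 w); first exact: (eta1 w).
  by move=> i c; rewrite !tnth_mktuple; exact: post_le_bayes.
exact: partg.
Qed.

Lemma label_clusterer (h : n.-tuple (borel T) -> n.-tuple 'I_2) :
  classifiers h -> clusterers (fun y => label_partition (h y)).
Proof.
move=> mh; split => [y|A]; first exact: label_partitionP.
have -> : (fun y => label_partition (h y)) @^-1` [set A] =
    \bigcup_(x in [set x | label_partition x = A]) (h @^-1` [set x]).
  apply/seteqP; split => y /=; first by exists (h y).
  by move=> [x /= <- ->].
by apply: fin_bigcup_measurable => // x _; exact: mh.
Qed.

Lemma clust_risk_label_le (h : n.-tuple (borel T) -> n.-tuple 'I_2) :
  classifiers h ->
  clust_risk P X Y (fun y => label_partition (h y)) <= class_risk P X Y h.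
Proof.
move=> mh; rewrite class_riskE.
pose phi2 (x k : n.-tuple 'I_2) : R := loss R (label_partition k) (label_partition x).
have -> : clust_risk P X Y (fun y => label_partition (h y)) =
    fine 'E_P[fun w => phi2 (X1n X n w) (h (Y1n Y n w))] by [].
rewrite !(hmm_expectation theta_ind XY mh).
apply: le_Rintegral => //; try exact: (condE_integrable XY mh).
move=> w _; apply: le_prodE; first exact: (eta0 w).
by move=> x; exact: loss_label_le.
Qed.

Lemma class_risk_infE : class_risk_inf P X Y n = bayes_risk.
Proof.
have lb : lbound [set class_risk P X Y h | h in classifiers (n := n)] bayes_risk.
  by move=> _ [h mh <-]; exact: class_risk_ge_bayes.
have bE : [set class_risk P X Y h | h in classifiers (n := n)] bayes_risk.
  exists (@bayes_classifier n); first exact: bayes_classifier_admissible.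
  exact: class_risk_bayes.
apply/eqP; rewrite eq_le; apply/andP; split.
  by apply: ge_inf => //; exists bayes_risk.
by apply: lb_le_inf => //; exists bayes_risk.
Qed.

Lemma clust_risk_inf_bounds :
  errE bayes_risk (fun x : n.-tuple 'I_2 =>
    1 / 2 - (2 * n%:R)^-1 * `|\sum_i sg (tnth x i == ord0)|) <= clust_risk_inf P X Y n
  /\ clust_risk_inf P X Y n <= bayes_risk.
Proof.
set e := errE _ _.
have lb : lbound [set clust_risk P X Y g | g in clusterers (n := n)] e.
  by move=> _ [g mg <-]; exact: clust_risk_ge.
pose g (y : n.-tuple (borel T)) := label_partition (bayes_classifier y).
have gP : [set clust_risk P X Y g | g in clusterers (n := n)] (clust_risk P X Y g).
  by exists g => //; exact: label_clusterer bayes_classifier_admissible.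
split; first by apply: lb_le_inf => //; exists (clust_risk P X Y g).
apply: (@le_trans _ _ (clust_risk P X Y g)); first by apply: ge_inf => //; exists e.
by rewrite -class_risk_bayes; exact: clust_risk_label_le bayes_classifier_admissible.
Qed.

End FixedSize.
End BayesRisk.

Theorem corollary1 (R : realType) (T : ptopologicalType) (T_polish : polish R T)
    (L : {sigma_finite_measure set (borel T) -> \bar R})
    (theta : param L 2) (theta_ind : Theta_ind theta)
    (d : measure_display) (Omega : measurableType d) (P : probability Omega R)
    (X : nat -> Omega -> 'I_2) (Y : nat -> Omega -> borel T)
    (XY_hmm : hmm P X Y theta)
    (n : nat) (n_ge2 : (2 <= n)%N) :
  let r_class := class_risk_inf P X Y n in
  let r_clust := clust_risk_inf P X Y n in
  let eps := 1 / 2 - r_class in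
  (1 - alpha n eps) * r_class <= r_clust /\ r_clust <= r_class.
Proof.
have n_gt0 : (0 < n)%N by exact: ltnW.
rewrite /= (class_risk_infE theta_ind XY_hmm n_gt0).
have [clust_ge clust_le] := clust_risk_inf_bounds theta_ind XY_hmm n_gt0.
split => //; apply: le_trans clust_ge; apply: errE_loss_ge => //.
  exact: bayes_risk_ge0.
exact: (bayes_risk_le_half theta_ind XY_hmm n_gt0).
Qed.
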